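(* If $G$ is a Type 3 bicyclic graph of order $n\ge 7$ with at least one leaf, then $\operatorname{CS}(G,x)\preceq \operatorname{CS}(B_n,x)$.
   Context: All graphs are finite, simple and undirected. A bicyclic graph is a connected graph $G$ with $|E(G)|=|V(G)|+1$. For integers $a,b,c\ge 0$ with at most one of them equal to $0$, $G_3(a,b,c)$ is the graph consisting of two vertices joined by three internally disjoint paths having $a$, $b$ and $c$ internal vertices respectively (so its order is $a+b+c+2$). A Type 3 bicyclic graph is a bicyclic graph containing some $G_3(a,b,c)$ as an induced subgraph. $B_n$ is the graph with vertices $c,a,b,w$ and $n-4$ further vertices, where $c$ is adjacent to all other vertices and the only other edges are $ab$ and $aw$. A connected set is a vertex subset inducing a connected subgraph; $S_k(G)$ is the number of connected sets of size $k$ and $\operatorname{CS}(G,x)=\sum_{k\ge1}S_k(G)x^k$. For polynomials $A(x)=\sum_{k=0}^n a_kx^k$, $B(x)=\sum_{k=0}^m b_kx^k$, write $B(x)\preceq A(x)$ if $m\le n$ and $b_k\le a_k$ for all $k$. *)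

(* Defs.v *)
From HB Require Import structures.
From mathcomp Require Import all_boot all_order all_algebra.

Set Implicit Arguments.
Unset Strict Implicit.
Unset Printing Implicit Defensive.

Import GRing.Theory.

Record sgraph := SGraph {
  vertex :> finType;
  adj : rel vertex;
  adj_sym : symmetric adj;
  adj_irr : irreflexive adj }.

Definition edges (G : sgraph) : {set {set G}} :=
  [set [set p.1; p.2] | p : G * G & adj p.1 p.2].

Definition degree (G : sgraph) (x : G) : nat := #|[set y | adj x y]|.

Definition is_leaf (G : sgraph) (x : G) : bool := degree x == 1.

(* The graph without vertices is not connected. *)
Definition connected (G : sgraph) : bool :=
  (0 < #|G|) && [forall x : G, forall y : G, connect (@adj G) x y].

Section Induced.
Variables (G : sgraph) (A : {set G}).

Definition induced_adj : rel {x : G | x \in A} :=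
  fun x y => adj (val x) (val y).

Lemma induced_sym : symmetric induced_adj.
Proof. by move=> x y; apply: adj_sym. Qed.

Lemma induced_irr : irreflexive induced_adj.
Proof. by move=> x; apply: adj_irr. Qed.

Definition induced : sgraph := SGraph induced_sym induced_irr.

End Induced.

Definition isomorphic (G H : sgraph) : Prop :=
  exists2 f : G -> H, bijective f & forall x y, adj (f x) (f y) = adj x y.

Definition contains_induced (G H : sgraph) : Prop :=
  exists A : {set G}, isomorphic (induced A) H.

Definition bicyclic (G : sgraph) : bool :=
  connected G && (#|edges G| == #|G| + 1).

Section Theta.
Variables a b c : nat.

Definition theta_len (p : 'I_3) : nat := nth 0 [:: a; b; c] p.

(* [inl false] and [inl true] are the two end vertices; [inr (Tagged _ j)], with
   tag [p], is the internal vertex number [j] (counted from 0) of path [p]. *)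
Definition theta_vertex : finType := (bool + {p : 'I_3 & 'I_(theta_len p)})%type.

(* The position of [u] along path [p] if [u] lies on it: the end vertices have
   positions 0 and [theta_len p + 1]. *)
Definition theta_pos (p : 'I_3) (u : theta_vertex) : option nat :=
  match u with
  | inl false => Some 0
  | inl true => Some (theta_len p).+1
  | inr q => if tag q == p then Some (tagged q).+1 else None
  end.

Definition theta_adj : rel theta_vertex := fun u v =>
  [exists p : 'I_3,
    match theta_pos p u, theta_pos p v with
    | Some i, Some j => (i.+1 == j) || (j.+1 == i)
    | _, _ => false
    end].

Lemma theta_sym : symmetric theta_adj.
Proof.
move=> u v; apply: eq_existsb => p.
by case: (theta_pos p u) (theta_pos p v) => [i|] [j|] //; rewrite orbC.
Qed.

Lemma theta_irr : irreflexive theta_adj.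
Proof.
move=> u; apply/existsP => -[p]; case: (theta_pos p u) => [i|] //.
by rewrite orbb gtn_eqF.
Qed.

Definition G3 : sgraph := SGraph theta_sym theta_irr.

End Theta.

Definition type3 (G : sgraph) : Prop :=
  bicyclic G /\
  exists a b c : nat,
    (a == 0) + (b == 0) + (c == 0) <= 1 /\ contains_induced G (G3 a b c).

Section Bn.
Variable n : nat.

(* The vertices c, a, b, w are 0, 1, 2, 3; this is the intended graph for
   [4 <= n] only. *)
Definition B_arc : rel 'I_n := fun u v =>
  [|| (u == 0 :> nat) && (v != 0 :> nat),
      (u == 1 :> nat) && (v == 2 :> nat)
    | (u == 1 :> nat) && (v == 3 :> nat)].

Definition B_adj : rel 'I_n := fun u v => B_arc u v || B_arc v u.

Lemma B_sym : symmetric B_adj.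
Proof. by move=> u v; rewrite /B_adj orbC. Qed.

Lemma B_irr : irreflexive B_adj.
Proof. by move=> u; rewrite /B_adj /B_arc; case: u => -[|[|m]]. Qed.

Definition B : sgraph := SGraph B_sym B_irr.

End Bn.

Definition connected_set (G : sgraph) (A : {set G}) : bool :=
  connected (induced A).

Definition S_ (G : sgraph) (k : nat) : nat :=
  #|[set A : {set G} | connected_set A & #|A| == k]|.

(* No connected set has more than #|G| vertices. *)
Definition CS (G : sgraph) : {poly nat} :=
  (\sum_(1 <= k < #|G|.+1) S_ G k *: 'X^k)%R.

(* [size] is the degree plus 1, and coefficients beyond the degree are 0. *)
Definition coef_le (p q : {poly nat}) : Prop :=
  size p <= size q /\ forall k : nat, (p`_k)%R <= (q`_k)%R.

(* Main.v *)
(* The bound is 'C(n-1, k-1), plus 1 for k = 3 and 2 for k = 2. A pendant vertex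
   x attached to y adds at most R <= 'C(n-1, k-2) connected k-sets to a graph of
   order n, R being the number of connected (k-1)-sets containing y, so by
   Pascal's rule the bound (for k >= 3) survives the addition of pendant
   vertices. An edge count shows that G arises in this way from its theta
   subgraph H of order m, so only the first steps have to be examined: none for
   m = 4, one pendant vertex for m >= 6, two of them for m = 5 (K_{2,3} with one
   leaf at a vertex of degree 3 violates the bound).
   For m >= 6 and a leaf attached to y, the bound for k >= 4 says that H - y has
   at most as many connected k-sets as H has disconnected sets of size k or k - 1
   containing y. Those in which y is isolated already number 'C(m-deg y, k-1).
   If deg y = 2 this suffices, because H - y is unicyclic, except when H - y is a
   cycle and k = m - 2, where one more disconnected set is needed. If deg y = 3 then H - y is a tree; deleting a neighbour
   y1 of y leaves a forest, which the isolated sets account for, and the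
   connected sets through y1 are sent to disconnected sets in which y is joined
   to a single other vertex. *)
Require Import Defs.
From mathcomp Require Import all_boot all_order all_algebra.
From mathcomp Require Import zify.

Set Implicit Arguments.
Unset Strict Implicit.
Unset Printing Implicit Defensive.

(** * Counting by injections between families of sets *)

Lemma leq_card_inj (aT rT : finType) (f : aT -> rT) (A : {set aT}) (B : {set rT}) :
  {in A &, injective f} -> {in A, forall x, f x \in B} -> #|A| <= #|B|.
Proof.
move=> injf fAB; rewrite -(card_in_imset injf); apply/subset_leq_card.
by apply/subsetP => _ /imsetP[x /fAB ? ->].
Qed.

Lemma setD1_inj (T : finType) (v : T) (A B : {set T}) :
  v \in A -> v \in B -> A :\ v = B :\ v -> A = B.
Proof. by move=> vA vB e; rewrite -(setD1K vA) e setD1K. Qed.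

Lemma leq_card_bigcup (I T : finType) (P : pred I) (F : I -> {set T}) :
  #|\bigcup_(i | P i) F i| <= \sum_(i | P i) #|F i|.
Proof.
elim/big_rec2: _ => [|i n A _ le]; first by rewrite cards0.
by apply: leq_trans (leq_card_setU _ _) _; rewrite leq_add2l.
Qed.

Lemma cardID_lt (T : finType) (A : {set T}) (P : pred T) (B : T) :
  B \in A -> ~~ P B -> #|[set x in A | P x]| < #|A|.
Proof.
move=> BA nP; apply: proper_card; apply/properP; split.
  by apply/subsetP => x; rewrite inE => /andP[].
by exists B; rewrite // inE BA.
Qed.

Lemma setU1_inj (T : finType) (v : T) (A B : {set T}) :
  v \notin A -> v \notin B -> v |: A = v |: B -> A = B.
Proof. by move=> vA vB e; rewrite -(setU1K vA) e setU1K. Qed.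

Lemma card_setI_split (T : finType) (A : {set T}) (P : pred T) :
  #|A| = #|[set x in A | P x]| + #|[set x in A | ~~ P x]|.
Proof.
rewrite -(cardsID [set x | P x] A); congr (_ + _); apply: eq_card => x.
  by rewrite !inE.
by rewrite !inE andbC.
Qed.

(** * Connected sets and degrees *)

Section Connectivity.
Variable G : sgraph.
Implicit Types (A B X Y : {set G}) (x y v : G).

Lemma connected_set_neq0 A : connected_set A -> A != set0.
Proof.
case/andP; rewrite card_sig => h _; rewrite -card_gt0.
by rewrite (eq_card (B := mem A)) in h.
Qed.

Lemma connected_set_cut A B : connected_set A -> B \subset A -> B != set0 ->
  B != A -> exists x y, [/\ x \in B, y \in A, y \notin B & adj x y].
Proof.
case/andP=> _ /forallP hc sBA /set0Pn[x xB] nBA.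
have /subsetPn[y yA yB]: ~~ (A \subset B).
  by apply: contra nBA => s; rewrite eqEsubset sBA.
have xA := subsetP sBA _ xB.
have /forallP/(_ (Sub y yA)) := hc (Sub x xA).
case: (boolP [exists x in B, [exists y in A :\: B, adj x y]]).
  case/exists_inP => a aB /exists_inP[b]; rewrite inE => /andP[bB bA] ab _.
  by exists a, b.
move=> nex con.
pose a : pred (induced A) := [pred u | val u \in B].
have cl : closed (@adj (induced A)) a.
  apply: intro_closed; first exact: sym_connect_sym (@adj_sym (induced A)).
  move=> u w uw uB; apply/negPn/negP => wB.
  case/negP: nex; apply/exists_inP; exists (val u) => //.
  apply/exists_inP; exists (val w) => //.
  by rewrite inE (valP w) andbT.
by have := closed_connect cl con; rewrite !inE /= xB (negPf yB).
Qed.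

(** The vertices of [A] reachable from [u] inside [A] form a set that no edge of [A] leaves. *)
Lemma connected_setI A : A != set0 ->
    (forall B, B \subset A -> B != set0 -> B != A ->
       exists x y, [/\ x \in B, y \in A, y \notin B & adj x y]) ->
  connected_set A.
Proof.
move=> A0 h; apply/andP; split.
  by rewrite card_sig (eq_card (B := mem A)) // card_gt0.
apply/forallP => u; apply/forallP => w; apply/negPn/negP => nc.
pose B := [set z in A | [exists z' : induced A,
   (val z' == z) && connect (@adj (induced A)) u z']].
have uB : val u \in B.
  by rewrite inE (valP u); apply/existsP; exists u; rewrite eqxx connect0.
have wB : val w \notin B.
  rewrite inE (valP w) /=; apply/existsP => -[z' /andP[/eqP/val_inj-> c]].
  by rewrite c in nc.
case: (h B) => [| | |x [y [xB yA yB xy]]].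
- by apply/subsetP => z; rewrite inE => /andP[].
- by apply/set0Pn; exists (val u).
- by apply: contraNneq wB => ->; apply: valP.
case/negP: yB; rewrite inE yA; apply/existsP; exists (Sub y yA).
rewrite SubK eqxx /=.
move: xB; rewrite inE => /andP[_ /existsP[z /andP[/eqP ez c]]].
by apply: connect_trans c (connect1 _); rewrite /= /induced_adj /= ez.
Qed.

Lemma disconnectedI A B : B \subset A -> B != set0 -> B != A ->
    (forall x y, x \in B -> y \in A -> adj x y -> y \in B) ->
  ~~ connected_set A.
Proof.
move=> s n0 nA h; apply/negP => /connected_set_cut-/(_ B s n0 nA).
by case=> x [y [xB yA yB /(h _ _ xB yA)]]; rewrite (negPf yB).
Qed.

Definition nbrs A x := [set y in A | adj x y].
Definition dg A x := #|nbrs A x|.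
(** Twice the number of edges induced on [A]. For connected [A], comparing it with twice [#|A|]
    gives the excess -2 for a tree, 0 for a unicyclic and 2 for a bicyclic graph. *)
Definition arcs A := \sum_(x in A) dg A x.

Lemma in_nbrs A x y : (y \in nbrs A x) = (y \in A) && adj x y.
Proof. by rewrite inE. Qed.

Lemma nbrs_sub A x : nbrs A x \subset A.
Proof. by apply/subsetP => y; rewrite inE => /andP[]. Qed.

Lemma dg_sub A B x : A \subset B -> dg A x <= dg B x.
Proof.
move=> s; apply/subset_leq_card/subsetP => y; rewrite !inE => /andP[yA ->].
by rewrite (subsetP s).
Qed.

Lemma dg_lt A x : x \in A -> dg A x < #|A|.
Proof.
move=> xA; rewrite (cardsD1 x A) xA ltnS; apply/subset_leq_card/subsetP => y.
rewrite !inE => /andP[-> xy]; rewrite andbT.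
by apply: contraTneq xy => ->; rewrite adj_irr.
Qed.

Lemma dgU1 A x y : x \notin A -> dg (x |: A) y = adj x y + dg A y.
Proof.
move=> xA; rewrite /dg.
have -> : nbrs (x |: A) y = (if adj x y then [set x] else set0) :|: nbrs A y.
  apply/setP => z; rewrite !inE; case: (z =P x) => [->|nzx] /=.
    by rewrite (adj_sym y); case: ifP; rewrite !inE ?eqxx ?andbF ?orbF.
  by case: ifP => _; rewrite !inE //; case: eqP nzx.
case: ifP => _; last by rewrite set0U.
by rewrite cardsU1 inE (negPf xA).
Qed.

Lemma dgD1 A x y : x \in A -> dg A y = adj x y + dg (A :\ x) y.
Proof. by move=> xA; rewrite -{1}(setD1K xA) dgU1 // !inE eqxx. Qed.

Lemma dg_sum A x : dg A x = \sum_(y in A) adj x y.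
Proof.
rewrite /dg -sum1dep_card big_mkcondr /=.
by apply: eq_bigr => y _; case: (adj x y).
Qed.

Lemma arcsU1 A x : x \notin A -> arcs (x |: A) = arcs A + (dg A x).*2.
Proof.
move=> xA; rewrite /arcs big_setU1 //= dgU1 // adj_irr add0n.
under eq_bigr => y _ do rewrite dgU1 //.
by rewrite big_split /= -dg_sum; lia.
Qed.

Lemma arcsD1 A x : x \in A -> arcs A = arcs (A :\ x) + (dg A x).*2.
Proof.
move=> xA; rewrite -{1}(setD1K xA) arcsU1 ?inE ?eqxx //.
by rewrite (dgD1 x xA) adj_irr.
Qed.

(** As [Y] is connected, it arises from [X] by adding vertices one at a time, each adjacent to the
    part already present. Each brings at least one edge, that is two arcs. *)
Lemma arcs_growth X Y : X \subset Y -> X != set0 -> connected_set Y ->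
  arcs X + #|Y|.*2 <= arcs Y + #|X|.*2.
Proof.
move=> sXY X0 cY.
have [k] := ubnP (#|Y| - #|X|); elim: k X sXY X0 => // k IH X sXY X0.
have [->|nXY] := eqVneq X Y; first by [].
case: (connected_set_cut cY sXY X0 nXY) => x [y [xX yY yX xy]].
rewrite ltnS => hk.
have pXY : #|X| < #|Y| by apply: proper_card; rewrite properEneq nXY.
have d : 0 < dg X y.
  by rewrite card_gt0; apply/set0Pn; exists x; rewrite inE xX adj_sym.
have sU : y |: X \subset Y.
  by apply/subsetP => z /setU1P[->|/(subsetP sXY)].
have U0 : y |: X != set0 by apply/set0Pn; exists y; rewrite !inE eqxx.
have := IH _ sU U0; rewrite arcsU1 // cardsU1 yX /= add1n => h.
by have := h ltac:(lia); lia.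
Qed.

Lemma dg_gt0 A x : connected_set A -> x \in A -> 1 < #|A| -> 0 < dg A x.
Proof.
move=> cA xA A1.
case: (connected_set_cut cA (B := [set x])) => [| | |a [b [/set1P-> bA _ ab]]].
- by rewrite sub1set.
- by apply/set0Pn; exists x; rewrite inE.
- by apply: contraTneq A1 => <-; rewrite cards1.
by rewrite card_gt0; apply/set0Pn; exists b; rewrite inE bA.
Qed.

(** If the neighbour [y] lies in [B], an edge leaving [x |: B] cannot start at [x]; otherwise an
    edge leaving [B] cannot end at [x]. *)
Lemma connectedD1_pendant A x : connected_set A -> 1 < #|A| -> dg A x <= 1 ->
  connected_set (A :\ x).
Proof.
move=> cA A1 dx.
have [xA|xA] := boolP (x \in A); last first.
  suff -> : A :\ x = A by [].
  apply/setP => z; rewrite !inE; case: eqP => // ->; exact/esym/negbTE.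
have dx1 : dg A x = 1 by have := dg_gt0 cA xA A1; lia.
have /cards1P[y ny] : #|nbrs A x| == 1 by apply/eqP.
apply: connected_setI.
  by rewrite -card_gt0; have := cardsD1 x A; rewrite xA; lia.
move=> B sB B0 nB.
have xB : x \notin B by apply/negP => /(subsetP sB); rewrite !inE eqxx.
have sBA : B \subset A by apply: subset_trans sB (subD1set _ _).
have hxy z : z \in A -> adj x z -> z = y.
  by move=> zA xz; apply/set1P; rewrite -ny inE zA.
have [yB|yB] := boolP (y \in B).
  case: (connected_set_cut cA (B := x |: B)) => [| | |a [b [aB bA bB ab]]].
  - by apply/subsetP => z /setU1P[->|/(subsetP sBA)].
  - by apply/set0Pn; exists x; rewrite !inE eqxx.
  - apply: contra nB => /eqP <-; rewrite setU1K //.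
  move: bB; rewrite !inE negb_or => /andP[bx bB].
  case/setU1P: aB => [ea|aB].
    by move: bB; rewrite (hxy b) ?yB // -ea.
  by exists a, b; rewrite !inE bx bA.
case: (connected_set_cut cA sBA B0) => [|a [b [aB bA bB ab]]].
  by apply: contraNneq xB => ->.
exists a, b; split=> //; rewrite !inE bA andbT.
apply: contraTneq ab => eb; rewrite eb adj_sym; apply/negP => xa.
by move: yB; rewrite -(hxy a) ?aB // (subsetP sBA).
Qed.

End Connectivity.

(** * Counting connected sets *)

Section Counting.
Variable G : sgraph.
Implicit Types (A B X Y : {set G}) (x y v : G).

Definition csets A k := [set B : {set G} | [&& B \subset A, #|B| == k & connected_set B]].
Definition csets_at v A k := [set B in csets A k | v \in B].
Definition dsets_at v A k :=
  [set B : {set G} | [&& B \subset A, #|B| == k, v \in B & ~~ connected_set B]].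

Lemma in_csets A k B :
  (B \in csets A k) = [&& B \subset A, #|B| == k & connected_set B].
Proof. by rewrite inE. Qed.

Lemma in_csets_at v A k B :
  (B \in csets_at v A k) = [&& B \subset A, #|B| == k, connected_set B & v \in B].
Proof. by rewrite inE in_csets -!andbA. Qed.

Lemma in_dsets_at v A k B :
  (B \in dsets_at v A k) = [&& B \subset A, #|B| == k, v \in B & ~~ connected_set B].
Proof. by rewrite inE. Qed.

Lemma card_sets_at v A k : v \in A ->
  #|[set B : {set G} | [&& B \subset A, #|B| == k.+1 & v \in B]]| = 'C(#|A|.-1, k).
Proof.
move=> vA; have -> : #|A|.-1 = #|A :\ v| by rewrite (cardsD1 v A) vA.
rewrite -cards_draws.
apply/eqP; rewrite eqn_leq; apply/andP; split.
  apply: (leq_card_inj (f := fun B => B :\ v)) => [B C|B].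
    by rewrite !inE => /and3P[_ _ vB] /and3P[_ _ vC]; apply: setD1_inj.
  rewrite !inE => /and3P[sB cB vB]; rewrite setSD //=.
  by move: cB; rewrite (cardsD1 v B) vB.
apply: (leq_card_inj (f := fun B => v |: B)) => [B C|B]; rewrite !inE.
  case/andP=> /subsetD1P[_ vB] _ /andP[/subsetD1P[_ vC] _] e.
  by rewrite -(setU1K vB) e setU1K.
case/andP=> /subsetD1P[sBA vB] cB.
by rewrite subUset sub1set vA sBA cardsU1 vB (eqP cB) add1n !eqxx.
Qed.

(** Used to trade bounds on connected sets for bounds on disconnected ones, once Pascal's rule has
    produced such binomials. *)
Lemma csets_at_dsets_at v A k : v \in A ->
  #|csets_at v A k.+1| + #|dsets_at v A k.+1| = 'C(#|A|.-1, k).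
Proof.
move=> vA; rewrite -(card_sets_at k vA).
rewrite -[RHS](cardsID [set B : {set G} | connected_set B]); congr (_ + _).
  apply: eq_card => B; rewrite in_csets_at !inE.
  by case: (connected_set B); rewrite ?andbF ?andbT //= ?andbA.
apply: eq_card => B; rewrite in_dsets_at. rewrite !inE.
by case: (connected_set B); rewrite ?andbF ?andbT //= !andbA.
Qed.

Lemma csets_at_le v A k : v \in A -> #|csets_at v A k.+1| <= 'C(#|A|.-1, k).
Proof. by move=> vA; rewrite -(csets_at_dsets_at k vA) leq_addr. Qed.

Lemma csets_le A k : #|csets A k| <= 'C(#|A|, k).
Proof.
rewrite -cards_draws; apply/subset_leq_card/subsetP => B.
by rewrite !inE => /and3P[-> ->].
Qed.

Lemma csets_split v A k : v \in A ->
  #|csets A k| = #|csets (A :\ v) k| + #|csets_at v A k|.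
Proof.
move=> vA; rewrite -(cardsID [set B : {set G} | v \in B]) addnC; congr (_ + _).
  apply: eq_card => B; rewrite !inE subsetD1.
  by case: (v \in B); rewrite ?andbF ?andbT.
by apply: eq_card => B; rewrite !inE.
Qed.

(** Removing [x] is injective on sets containing it. As [k] is positive, a connected set counted on
    the left also contains a neighbour of [x]. *)
Lemma csets_at_pendant_sub x A k : 0 < k -> x \in A -> dg A x <= 1 ->
  #|csets_at x A k.+1| <=
    #|[set B in csets (A :\ x) k | [exists y in nbrs A x, y \in B]]|.
Proof.
move=> k0 xA dx; apply: (leq_card_inj (f := fun B => B :\ x)) => [B C|B].
  by rewrite !inE => /andP[_ xB] /andP[_ xC]; apply: setD1_inj.
rewrite !inE => /andP[/and3P[sB cB nB] xB].
have dB : dg B x <= 1 by apply: leq_trans (dg_sub x sB) dx.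
have B1 : 1 < #|B| by rewrite (eqP cB) ltnS.
rewrite setSD //= connectedD1_pendant // andbT.
rewrite (cardsD1 x B) xB in cB; rewrite -eqSS cB /=.
have /card_gt0P[y] := dg_gt0 nB xB B1; rewrite in_nbrs => /andP[yB xy].
apply/exists_inP; exists y; first by rewrite in_nbrs (subsetP sB _ yB).
by rewrite !inE yB andbT; apply: contraTneq xy => ->; rewrite adj_irr.
Qed.

Lemma csets_at_pendant x y A k : 0 < k -> x \in A -> nbrs A x = [set y] ->
  #|csets_at x A k.+1| <= #|csets_at y (A :\ x) k|.
Proof.
move=> k0 xA nx; apply: leq_trans (csets_at_pendant_sub k0 xA _) _.
  by rewrite /dg nx cards1.
apply/subset_leq_card/subsetP => B; rewrite !inE => /andP[-> /exists_inP[z]].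
by rewrite nx inE => /eqP->.
Qed.

Lemma csets_pendant x y A k : 0 < k -> x \in A -> nbrs A x = [set y] ->
  #|csets A k.+1| <= #|csets (A :\ x) k.+1| + #|csets_at y (A :\ x) k|.
Proof.
by move=> k0 xA nx; rewrite (csets_split _ xA) leq_add2l csets_at_pendant.
Qed.

(** Forests, in a form inherited by subsets that directly supplies the vertex removed in an
    induction. *)
Definition acyclic A := forall X, X \subset A -> X != set0 ->
  exists2 x, x \in X & dg X x <= 1.

(** Remove a vertex of degree at most 1: the sets through it inject into the sets through its
    neighbour, and Pascal's rule adds the two bounds. *)
Lemma csets_acyclic A k : acyclic A -> #|csets A k.+2| <= 'C(#|A|.-1, k.+1).
Proof.
have [n] := ubnP #|A|; elim: n A => // n IH A hA acA.
have [A1|A1] := leqP #|A| 1.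
  by apply: leq_trans (csets_le _ _) _; rewrite bin_small //; lia.
have A0 : A != set0 by rewrite -card_gt0; lia.
have [x xA dx] := acA A (subxx _) A0.
have cA : #|A| = #|A :\ x|.+1 by rewrite (cardsD1 x A) xA.
have acD : acyclic (A :\ x).
  by move=> X sX; apply: acA; apply: subset_trans sX (subD1set _ _).
have := IH (A :\ x) ltac:(lia) acD; rewrite (csets_split _ xA) => h.
have e : #|A|.-1 = #|A :\ x|.-1.+1 by lia.
rewrite e binS; apply: leq_add => //.
have [N0|[y yN]] := set_0Vmem (nbrs A x).
  apply: leq_trans (csets_at_pendant_sub _ xA dx) _ => //.
  rewrite [X in X <= _](_ : _ = 0) //; apply/eqP; rewrite cards_eq0.
  apply/eqP/setP => B; rewrite in_set0 inE; apply/negP => /andP[_ /exists_inP[z]].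
  by rewrite N0 inE.
have nx : nbrs A x = [set y].
  apply/eqP; rewrite eq_sym eqEcard sub1set yN cards1 //=.
apply: leq_trans (csets_at_pendant _ xA nx) _ => //; apply: csets_at_le.
move: yN; rewrite in_nbrs !inE => /andP[-> xy]; rewrite andbT.
by apply: contraTneq xy => ->; rewrite adj_irr.
Qed.

End Counting.

(** * Unicyclic graphs *)

Section Unicyclic.
Variable G : sgraph.
Implicit Types (A B C X Y T : {set G}) (x y v p : G).

Lemma adj_neq x y : adj x y -> x != y.
Proof. by apply: contraTneq => ->; rewrite adj_irr. Qed.

Lemma connected_set_closed A X : connected_set A -> X \subset A -> X != set0 ->
  (forall x y, x \in X -> y \in A -> adj x y -> y \in X) -> X = A.
Proof.
move=> cA sX X0 h; apply/eqP/negPn/negP => nX.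
by have := disconnectedI sX X0 nX h; rewrite cA.
Qed.

Lemma nbrs_eq_sub A X x : X \subset A -> dg A x <= dg X x -> nbrs X x = nbrs A x.
Proof.
move=> sX d; apply/eqP; rewrite eqEcard d andbT; apply/subsetP => y.
by rewrite !in_nbrs => /andP[/(subsetP sX)-> ->].
Qed.

Lemma connected_set_closed_dg A X : connected_set A -> X \subset A -> X != set0 ->
  (forall x, x \in X -> dg A x <= dg X x) -> X = A.
Proof.
move=> cA sX X0 h; apply: connected_set_closed => // x y xX yA xy.
have : y \in nbrs A x by rewrite in_nbrs yA.
by rewrite -(nbrs_eq_sub sX (h x xX)) in_nbrs => /andP[].
Qed.

Lemma arcs_ge c A : (forall x, x \in A -> c <= dg A x) -> c * #|A| <= arcs A.
Proof. by move=> h; rewrite mulnC -sum_nat_const; apply: leq_sum. Qed.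

Lemma arcs_regular c A : (forall x, x \in A -> c <= dg A x) ->
  arcs A <= c * #|A| -> forall x, x \in A -> dg A x = c.
Proof.
move=> h le x xA; apply/eqP; rewrite eqn_leq h // andbT leqNgt; apply/negP => lt.
move: le; rewrite leqNgt => /negP[]; rewrite mulnC -sum_nat_const /arcs.
rewrite (bigD1 x) //= [X in _ < X](bigD1 x) //= -addSn leq_add //.
by apply: leq_sum => y /andP[/h].
Qed.

Lemma arcs_connected A : connected_set A -> #|A|.*2 <= arcs A + 2.
Proof.
move=> cA; have /set0Pn[x xA] := connected_set_neq0 cA.
have := arcs_growth (X := [set x]) (Y := A); rewrite sub1set => /(_ xA _ cA).
rewrite cards1 => h; have : [set x] != set0 by apply/set0Pn; exists x; rewrite inE.
by move/h; lia.
Qed.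

(** The set consists of [v] and [k.+1] of its non-neighbours, so [v] is an isolated vertex of it. *)
Lemma dsets_isolated v A k : v \in A ->
  'C(#|A| - (dg A v).+1, k.+1) <=
  #|[set B in dsets_at v A k.+2 | [disjoint nbrs A v & B]]|.
Proof.
move=> vA; have vN : v \in A :\: nbrs A v by rewrite !inE vA adj_irr.
have -> : #|A| - (dg A v).+1 = #|A :\: nbrs A v|.-1.
  by rewrite cardsD (setIidPr (nbrs_sub A v)) -subn1 -subnDA addn1.
rewrite -(card_sets_at _ vN); apply/subset_leq_card/subsetP => B.
rewrite inE subsetD => /and3P[/andP[sB dB] cB vB].
rewrite inE in_dsets_at sB cB vB disjoint_sym dB /= andbT.
apply: (disconnectedI (B := [set v])).
- by rewrite sub1set.
- by apply/set0Pn; exists v; rewrite inE.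
- by apply: contraTneq cB => <-; rewrite cards1.
move=> x y /set1P-> yB vy; have := disjointFr dB yB.
by rewrite in_nbrs vy (subsetP sB).
Qed.

Lemma csets_at_nbr A B x y k : nbrs A x = [set y] -> B \in csets_at x A k.+2 -> y \in B.
Proof.
move=> nx; rewrite in_csets_at => /and4P[sB cB nB xB].
have /card_gt0P[z] : 0 < dg B x by apply: dg_gt0 => //; rewrite (eqP cB).
rewrite in_nbrs => /andP[zB xz].
have : z \in nbrs A x by rewrite in_nbrs xz (subsetP sB).
by rewrite nx => /set1P<-.
Qed.

(** It suffices to compare the connected sets of the path [T] with the disconnected sets at [v].
    Those missing [y1] lie in a forest and are paid for by the sets isolating [v]. In the others [p]
    is exchanged for [v], which makes [v] and [y1] a component. *)
Lemma csets_cycle C k : connected_set C -> (forall x, x \in C -> dg C x = 2) ->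
  k.+4 < #|C| -> #|csets C k.+3| <= 'C(#|C|.-1, k.+2).
Proof.
move=> cC d2 hk; have /set0Pn[v vC] := connected_set_neq0 cC.
have /eqP/cards2P[y1 [y2 [y12 Nv]]] := d2 v vC.
set T := C :\ v.
have cT : #|C| = #|T|.+1 by rewrite (cardsD1 v C) vC.
have acT : acyclic T.
  move=> X sX X0; apply/exists_inP; apply: contraT.
  rewrite negb_exists_in => /forall_inP h.
  have /subsetD1P[sXC vX] := sX.
  have XC : X = C.
    apply: connected_set_closed_dg => // x xX.
    by rewrite d2 ?(subsetP sXC) // ltnNge h.
  by rewrite XC vC in vX.
have /andP[y1C vy1] : (y1 \in C) && adj v y1 by rewrite -in_nbrs Nv !inE eqxx.
have /andP[y2C vy2] : (y2 \in C) && adj v y2 by rewrite -in_nbrs Nv !inE eqxx orbT.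
have y1T : y1 \in T by rewrite !inE y1C andbT eq_sym adj_neq.
have dT1 : dg T y1 = 1.
  by apply/eqP; rewrite -eqSS -(d2 y1 y1C) (dgD1 _ vC) vy1.
have /eqP/cards1P[p Np] := dT1.
have pT : p \in T by have := nbrs_sub T y1; rewrite Np sub1set.
rewrite (csets_split _ vC) -/T -(csets_at_dsets_at k.+2 vC) addnC leq_add2l.
rewrite (csets_split _ y1T) -(cardsID [set B : {set G} | y1 \in B] (dsets_at _ _ _)).
rewrite addnC; apply: leq_add; last first.
  apply: leq_trans (csets_acyclic _ _) _.
    by move=> X sX; apply: acT; apply: subset_trans sX (subD1set _ _).
  have -> : #|T :\ y1|.-1 = #|C| - (dg C v).+1.
    by rewrite d2 // cT (cardsD1 y1 T) y1T; lia.
  apply: leq_trans (dsets_isolated _ vC) _.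
  apply/subset_leq_card/subsetP => B; rewrite inE => /andP[dB hB].
  rewrite inE dB inE andbT (disjointFr hB) //.
  by rewrite Nv !inE eqxx.
(* A connected set containing both neighbours of [v] closes up with [v] to the whole cycle, which
   has more than [k.+4] vertices. *)
have y2A A : A \in csets_at y1 T k.+3 -> y2 \notin A.
  rewrite in_csets_at => /and4P[/subsetD1P[sA vA] cA nA y1A]; apply/negP => y2A.
  have sX : v |: A \subset C by rewrite subUset sub1set vC.
  have X0 : v |: A != set0 by apply/set0Pn; exists v; rewrite setU11.
  have dv : 2 <= dg A v.
    rewrite -(d2 v vC); apply/subset_leq_card/subsetP => y.
    rewrite [in X in X -> _]Nv !inE => /orP[]/eqP->; rewrite ?vy1 ?vy2 ?andbT //.
  have aX : 2 * #|v |: A| <= arcs (v |: A).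
    rewrite (arcsU1 vA) cardsU1 vA add1n mulnS mul2n.
    apply: leq_trans (_ : arcs A + 2 + 2 <= _).
      by rewrite addnC leq_add2r arcs_connected.
    by rewrite -addnA leq_add2l -mul2n (leq_mul2l 2 2).
  have XC : v |: A = C.
    apply: connected_set_closed_dg => // x xX.
    rewrite d2 ?(subsetP sX) //.
    rewrite leqNgt; apply/negP => lt.
    have le2 y : y \in v |: A -> dg (v |: A) y <= 2.
      by move=> yX; rewrite -(d2 y) ?(subsetP sX) // dg_sub.
    move: aX; rewrite leqNgt => /negP[]; rewrite mulnC -sum_nat_const /arcs.
    rewrite (bigD1 x) //= [X in _ < X](bigD1 x) //= -addSn leq_add //.
    by apply: leq_sum => y /andP[/le2].
  by move: hk; rewrite -XC cardsU1 vA (eqP cA) ltnn.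
apply: (leq_card_inj (f := fun A => v |: (A :\ p))) => [A B hA hB|A hA].
  have pA := csets_at_nbr Np hA; have pB := csets_at_nbr Np hB.
  move: hA hB; rewrite !in_csets_at.
  case/and4P=> /subsetD1P[_ vA] _ _ _ /and4P[/subsetD1P[_ vB] _ _ _] e.
  apply: (setD1_inj pA pB).
  rewrite -[A :\ p](@setU1K _ v) ?e ?setU1K // !inE negb_and.
    by rewrite vB orbT.
  by rewrite vA orbT.
have pA := csets_at_nbr Np hA; have y2nA := y2A A hA.
move: hA; rewrite in_csets_at => /and4P[/subsetD1P[sA vA] /eqP cA nA y1A].
have p1 : adj y1 p by have : p \in nbrs T y1 by [rewrite Np inE]; rewrite in_nbrs => /andP[].
have cB : #|v |: (A :\ p)| = k.+3.
  by rewrite cardsU1 !inE negb_and vA orbT -cA (cardsD1 p A) pA.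
rewrite inE in_dsets_at cB eqxx setU11 subUset sub1set vC /= !inE y1A andbT.
rewrite (adj_neq p1) orbT andbT.
rewrite (subset_trans (subD1set _ _) sA) /=.
apply: (disconnectedI (B := [set v; y1])).
- by rewrite subUset !sub1set !inE eqxx y1A (adj_neq p1) orbT.
- by apply/set0Pn; exists v; rewrite !inE eqxx.
- by apply/eqP => e; move: cB; rewrite -e cards2; case: (_ != _).
move=> x y; rewrite !inE => /orP[]/eqP-> /orP[->//|/andP[yp yA]] xy.
  have : y \in nbrs C v by rewrite in_nbrs xy (subsetP sA).
  rewrite Nv !inE => /orP[/eqP->|/eqP ey]; first by rewrite eqxx orbT.
  by rewrite -ey yA in y2nA.
have : y \in nbrs T y1.
  rewrite in_nbrs xy !inE (subsetP sA) // !andbT; by apply: contraNneq vA => <-.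
by rewrite Np inE (negPf yp).
Qed.

(** The correction is for a cycle of order [k.+4], with [k.+4] connected sets of size [k.+3] against
    a binomial equal to [k.+3]. Leaves are removed by induction until a cycle remains. *)
Lemma csets_unicyclic T k : connected_set T -> arcs T = #|T|.*2 ->
  #|csets T k.+3| <=
    'C(#|T|.-1, k.+2) + [forall x in T, dg T x == 2] && (#|T| == k.+4).
Proof.
have [n] := ubnP #|T|; elim: n T => // n IH T hT cT aT.
have [T1|T1] := leqP #|T| 1.
  by apply: leq_trans (csets_le _ _) _; rewrite bin_small //; lia.
case: (boolP [exists x in T, dg T x <= 1]) => [/exists_inP[x xT dx]|].
  have dx1 : dg T x = 1 by have := dg_gt0 cT xT T1; lia.
  have /eqP/cards1P[y Nx] := dx1.
  have yT : y \in T :\ x.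
    have : y \in nbrs T x by rewrite Nx inE.
    by rewrite in_nbrs !inE => /andP[-> xy]; rewrite eq_sym adj_neq.
  have cD : #|T| = #|T :\ x|.+1 by rewrite (cardsD1 x T) xT.
  have := IH (T :\ x) ltac:(lia) (connectedD1_pendant cT T1 dx).
  have := arcsD1 xT; rewrite dx1 aT => aD /(_ ltac:(lia)) h.
  apply: leq_trans (csets_pendant _ xT Nx) _ => //.
  have e : #|T|.-1 = #|T :\ x|.-1.+1.
    by have := cardsD1 y (T :\ x); rewrite yT; lia.
  rewrite e binS.
  have cd := csets_at_dsets_at k.+1 yT.
  move: h; case: (boolP (_ && _)) => [/andP[/forall_inP d2 /eqP cTx]|_]; last by lia.
  (* [T :\ x] is the exceptional cycle. Its excess of 1 is absorbed by the disconnected set made of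
     [y] and its non-neighbours. *)
  have := dsets_isolated k yT; rewrite (eqP (d2 y yT)) cTx subSS subSS subSS subn0.
  rewrite binn => /leq_trans/(_ (subset_leq_card _))-/(_ (dsets_at y (T :\ x) k.+2)).
  move=> h1 h2.
  have := h1 ltac:(by apply/subsetP => B; rewrite inE => /andP[]).
  by move: h2 cd; rewrite cTx; lia.
rewrite negb_exists_in => /forall_inP h.
have d2 : forall x, x \in T -> dg T x = 2.
  apply: arcs_regular => [x xT|]; first by rewrite ltnNge h.
  by rewrite aT; lia.
have -> : [forall x in T, dg T x == 2] by apply/forall_inP => x xT; rewrite d2.
have [hk|hk] := ltnP k.+4 #|T|.
  by apply: leq_trans (csets_cycle cT d2 hk) (leq_addr _ _).
(* On a cycle of order at most [k.+4], counting all subsets of size [k.+3] is enough. *)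
apply: leq_trans (csets_le _ _) _.
have [->|n4] := eqVneq #|T| k.+4; first by rewrite /= !binSn; lia.
have [->|n3] := eqVneq #|T| k.+3; first by rewrite /= !binn.
by rewrite bin_small //; lia.
Qed.

End Unicyclic.

(** * Theta graphs *)

Lemma dsets_edge (G : sgraph) (A B : {set G}) (v y : G) k :
    B \subset A -> #|B| = k.+3 -> v \in B -> y \in B ->
    (forall z, z \in B -> adj v z -> z = y) ->
    (forall z, z \in B -> adj y z -> z = v) ->
  B \in dsets_at v A k.+3.
Proof.
move=> sB cB vB yB hv hy; rewrite in_dsets_at sB cB eqxx vB /=.
apply: (disconnectedI (B := [set v; y])).
- by rewrite subUset !sub1set vB yB.
- by apply/set0Pn; exists v; rewrite !inE eqxx.
- by apply/eqP => e; move: cB; rewrite -e cards2; case: (_ != _).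
move=> a b /set2P[]-> bB ab; first by rewrite (hv b) // !inE eqxx orbT.
by rewrite (hy b) // !inE eqxx.
Qed.

Section Theta.
Variables (G : sgraph) (H : {set G}).
Implicit Types (A B C X Y T : {set G}) (x y v p : G).
Hypothesis H4 : 3 < #|H|.
(** Theta graphs enter through two properties: no vertex disconnects them, and, from [arcsH] on,
    they have one edge more than vertices. *)
Hypothesis connD1 : forall z, z \in H -> connected_set (H :\ z).

(** After deleting one neighbour [y], the rest is still connected, so [x] has a second neighbour. *)
Lemma theta_dg_ge2 x : x \in H -> 2 <= dg H x.
Proof.
move=> xH; have cH z : z \in H -> #|H| = #|H :\ z|.+1 by move=> zH; rewrite (cardsD1 z H) zH.
have gt0 z : z \in H -> z != x -> 0 < dg (H :\ z) x.
  move=> zH zx; apply: dg_gt0; first exact: connD1.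
    by rewrite !inE xH eq_sym zx.
  by have := cH z zH; lia.
have /card_gt0P[z] : 0 < #|H :\ x| by have := cH x xH; lia.
rewrite !inE => /andP[zx zH].
have /card_gt0P[y] : 0 < dg H x.
  by apply: leq_trans (gt0 z zH zx) (dg_sub _ (subD1set _ _)).
rewrite in_nbrs => /andP[yH xy]; rewrite (dgD1 x yH) (adj_sym y) xy.
by have := gt0 y yH; rewrite eq_sym (adj_neq xy) => /(_ isT); lia.
Qed.

Hypothesis arcsH : arcs H = (#|H|.+1).*2.

(** The connected set [H :\ x] retains at least [#|H| - 2] of the [#|H| + 1] edges. *)
Lemma theta_dg_le3 x : x \in H -> dg H x <= 3.
Proof.
move=> xH; have := arcs_connected (connD1 xH); have := arcsD1 xH.
have := cardsD1 x H; rewrite xH; lia.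
Qed.

(** All degrees are at least 2 and sum to [2 * #|H| + 2], so at most two vertices have degree 3. *)
Lemma theta_dg3_uniq x y z : x \in H -> y \in H -> z \in H ->
  dg H x = 3 -> dg H y = 3 -> dg H z = 3 -> x != y -> x != z -> y = z.
Proof.
move=> xH yH zH dx dy dz xy xz; apply/eqP/negPn/negP => yz.
have : 2 * #|H| + 3 <= arcs H; last by rewrite arcsH; lia.
have yD : y \in H :\ x by rewrite !inE yH eq_sym xy.
have zD : z \in H :\ x :\ y by rewrite !inE zH eq_sym yz eq_sym xz.
rewrite /arcs (big_setD1 x) //= (big_setD1 y) //= (big_setD1 z) //= dx dy dz.
rewrite (cardsD1 x H) xH (cardsD1 y) yD (cardsD1 z) zD.
suff : 2 * #|H :\ x :\ y :\ z| <= \sum_(i in H :\ x :\ y :\ z) dg H i by lia.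
rewrite mulnC -sum_nat_const; apply: leq_sum => i; rewrite !inE.
by case/and4P=> _ _ _; apply: theta_dg_ge2.
Qed.

(* Each connected triple is a vertex with two of its neighbours, and
   'C(d, 2) = 2 * d - 3 for d = 2, 3. *)
Lemma theta_csets3 : #|csets H 3| <= #|H| + 4.
Proof.
pose F x := [set x |: P | P in [set P : {set G} | P \subset nbrs H x & #|P| == 2]].
have sub : csets H 3 \subset \bigcup_(x in H) F x.
  apply/subsetP => B; rewrite in_csets => /and3P[sB cB nB].
  suff [x xB hx] : exists2 x, x \in B & forall y, y \in B -> y != x -> adj x y.
    apply/bigcupP; exists x; first exact: (subsetP sB).
    apply/imsetP; exists (B :\ x); last by rewrite setD1K.
    rewrite inE; apply/andP; split; last by move: cB; rewrite (cardsD1 x B) xB.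
    apply/subsetP => y; rewrite !inE => /andP[yx yB].
    by rewrite (subsetP sB) //= hx.
  have [x [y [xB yB xy d]]] : exists x y, [/\ x \in B, y \in B, adj x y & 2 <= dg B x].
    have : ~~ [forall x in B, dg B x <= 1].
      apply/negP => /forall_inP h.
      have := arcs_connected nB; rewrite (eqP cB).
      have : arcs B <= 1 * #|B| by rewrite mulnC -sum_nat_const; apply: leq_sum.
      by rewrite (eqP cB); lia.
    rewrite negb_forall_in => /exists_inP[x xB]; rewrite -ltnNge => d.
    have /card_gt0P[y] : 0 < dg B x by lia.
    by rewrite in_nbrs => /andP[yB xy]; exists x, y.
  exists x => // z zB zx.
  have e : nbrs B x = B :\ x.
    apply/eqP; rewrite eqEcard; apply/andP; split.
      apply/subsetP => t; rewrite in_nbrs !inE => /andP[-> /adj_neq].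
      by rewrite eq_sym => ->.
    by have := cardsD1 x B; rewrite xB (eqP cB) -/(dg B x); lia.
  by have : z \in nbrs B x; [rewrite e !inE zx | rewrite in_nbrs => /andP[]].
apply: leq_trans (subset_leq_card sub) _.
apply: leq_trans (leq_card_bigcup _ _) _.
have h x : x \in H -> #|F x| + 3 <= 2 * dg H x.
  move=> xH; apply: leq_trans (_ : 'C(dg H x, 2) + 3 <= _).
    by rewrite leq_add2r -cards_draws leq_imset_card.
  by have := theta_dg_ge2 xH; have := theta_dg_le3 xH; case: (dg H x) => [|[|[|[|]]]].
have : \sum_(x in H) (#|F x| + 3) <= \sum_(x in H) 2 * dg H x by apply: leq_sum.
rewrite big_split sum_nat_const -big_distrr /= -/(arcs H) arcsH; lia.
Qed.

(** * Deleting a vertex from a theta graph of order at least 6 *)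

Hypothesis H6 : 5 < #|H|.

(** Here [x], not [v], is the isolated vertex. This serves the size [#|H| - 2], where the sets
    isolating [v] do not suffice. *)
Lemma theta_dsets_pair x v : x \in H -> v \in H -> dg H x = 2 -> v != x ->
  ~~ adj v x -> H :\: nbrs H x \in dsets_at v H (#|H| - 2).
Proof.
move=> xH vH dx vx nvx; rewrite in_dsets_at subsetDl cardsD (setIidPr (nbrs_sub H x)).
rewrite -/(dg H x) dx eqxx !inE vH andbT /= adj_sym nvx /=.
have xB : x \in H :\: nbrs H x by rewrite !inE xH adj_irr.
apply: (disconnectedI (B := [set x])).
- by rewrite sub1set.
- by apply/set0Pn; exists x; rewrite inE.
- apply/eqP => /setP/(_ v); rewrite !inE vH (negPf vx) adj_sym (negPf nvx).
  by [].
by move=> a b /set1P->; rewrite !inE => /andP[/negP h bH] ab; case: h; rewrite bH.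
Qed.

Lemma theta_del_dg2 v k : v \in H -> dg H v = 2 ->
  #|csets (H :\ v) k.+4| <= #|dsets_at v H k.+4| + #|dsets_at v H k.+3|.
Proof.
move=> vH dv; set T := H :\ v.
have cT : #|H| = #|T|.+1 by rewrite (cardsD1 v H) vH.
have aT : arcs T = #|T|.*2.
  by have := arcsD1 vH; rewrite arcsH dv cT -/T; lia.
apply: leq_trans (csets_unicyclic _ (connD1 vH) aT) _.
have i4 := dsets_isolated k.+2 vH; have i3 := dsets_isolated k.+1 vH.
rewrite dv in i4 i3.
have e : #|T|.-1 = (#|H| - 3).+1 by lia.
rewrite e binS addnAC; apply: leq_add; last first.
  apply: leq_trans i3 _; apply/subset_leq_card/subsetP => B.
  by rewrite inE => /andP[].
case: (boolP (_ && _)) => [/andP[/forall_inP d2 /eqP hT]|_]; last first.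
  rewrite addn0; apply: leq_trans i4 _; apply/subset_leq_card/subsetP => B.
  by rewrite inE => /andP[].
rewrite addn1; apply: leq_ltn_trans i4 _.
(* In the exceptional case one more disconnected set is needed, not isolating [v]. It is the
   complement of the neighbourhood of some [x] adjacent neither to [v] nor to its neighbour [y]; at
   most 2 + 3 vertices are excluded. *)
have /card_gt0P[y yN] : 0 < dg H v by rewrite dv.
have /andP[yH vy] : (y \in H) && adj v y by rewrite -in_nbrs.
have /card_gt0P[x] : 0 < #|H :\: (nbrs H v :|: nbrs H y)|.
  rewrite cardsDS ?subUset ?nbrs_sub // subn_gt0.
  apply: leq_trans H6; rewrite ltnS; apply: leq_trans (leq_card_setU _ _) _.
  by rewrite -/(dg H v) -/(dg H y) dv (leq_add2l 2 _ 3) theta_dg_le3.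
rewrite !inE => /andP[]; case xH : (x \in H); last by [].
rewrite !andTb negb_or => /andP[nvx nyx] _.
have xv : v != x by apply: contraNneq nyx => <-; rewrite adj_sym.
have dx : dg H x = 2.
  rewrite (dgD1 x vH) (negPf nvx) add0n; apply/eqP/d2.
  by rewrite !inE xH eq_sym xv.
have := theta_dsets_pair xH vH dx xv nvx.
have -> : #|H| - 2 = k.+4 by rewrite cT hT subSS subSS subn0.
move/cardID_lt; apply.
rewrite -setI_eq0; apply/set0Pn; exists y.
by rewrite !inE yH vy /= andbT adj_sym.
Qed.

(** At most one neighbour of [v] has degree 3, so two of them, [a] and [b], have degree 2. One that
    is not adjacent to the third neighbour [c] serves as [y1], the other as [y3]. If both were
    adjacent to [c], only [v] could join [a], [b], [c] to the rest. *)
Lemma theta_dg3_nbrs v : v \in H -> dg H v = 3 ->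
  exists y1 y2 y3 p, [/\ nbrs H v = [set y1; y2; y3], [&& y1 != y2, y1 != y3 & y2 != y3],
   nbrs H y1 = [set v; p], p \notin nbrs H v & dg H y3 = 2].
Proof.
move=> vH dv; have cT := connD1 vH.
have cardT : #|H :\ v|.+1 = #|H| by rewrite (cardsD1 v H) vH.
have [a [b [c [Nv /and3P[ab ac bc] [da db]]]]] : exists a b c,
  [/\ nbrs H v = [set a; b; c], [&& a != b, a != c & b != c] & dg H a = 2 /\ dg H b = 2].
  have : 1 < #|[set y in nbrs H v | dg H y == 2]|.
    rewrite ltnNge; apply/negP => le1.
    have : 1 < #|[set y in nbrs H v | dg H y == 3]|.
      have : dg H v <= #|[set y in nbrs H v | dg H y == 2]| +
                       #|[set y in nbrs H v | dg H y == 3]|.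
        apply: leq_trans (leq_card_setU _ _); apply/subset_leq_card/subsetP => y yN.
        rewrite !inE -!in_nbrs yN /=; have yH := subsetP (nbrs_sub H v) _ yN.
        by have := theta_dg_ge2 yH; have := theta_dg_le3 yH; case: (dg H y) => [|[|[|[|]]]].
      by rewrite dv; move: le1; lia.
    case/card_gt1P => y [z [+ + yz]].
    rewrite !inE => /andP[/andP[yH vy] /eqP dy] /andP[/andP[zH vz] /eqP dz].
    case/eqP: yz; apply: (theta_dg3_uniq vH) => //; exact: adj_neq.
  case/card_gt1P => a [b [+ + ab]]; rewrite !inE -!in_nbrs.
  move=> /andP[aN /eqP da] /andP[bN /eqP db].
  have sN : [set a; b] \subset nbrs H v by rewrite subUset !sub1set aN bN.
  have /cards1P[c Nc] : #|nbrs H v :\: [set a; b]| == 1.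
    by rewrite cardsDS // cards2 ab -/(dg H v) dv.
  have : c \in nbrs H v :\: [set a; b] by rewrite Nc inE.
  rewrite !inE negb_or => /andP[/andP[ca cb] _].
  exists a, b, c; split=> //; last by rewrite ab eq_sym ca eq_sym cb.
  by rewrite -Nc setUC -{1}(setID (nbrs H v) [set a; b]) (setIidPr sN) setUC.
(* By connectivity such an [X] would be all of [H :\ v], which has at least five vertices, while [v]
   has three neighbours. *)
have closedN X : X \subset nbrs H v -> X != set0 ->
    (forall x, x \in X -> nbrs H x \subset v |: X) -> False.
  move=> sX X0 h; have XT : X = H :\ v.
    apply: connected_set_closed => // [|x y xX].
      apply: subset_trans sX _; apply/subsetP => x; rewrite in_nbrs !inE.
      by case/andP=> -> /adj_neq; rewrite eq_sym => ->.
    rewrite !inE => /andP[yv yH] xy.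
    have := subsetP (h x xX) y; rewrite in_nbrs yH xy => /(_ isT).
    by rewrite !inE (negPf yv).
  have := subset_leq_card sX; rewrite -/(dg H v) dv XT.
  by have := H6; lia.
have key a' b' c' : nbrs H v = [set a'; b'; c'] -> a' != b' -> a' != c' -> b' != c' ->
   dg H a' = 2 -> dg H b' = 2 -> ~~ adj a' c' ->
  exists y1 y2 y3 p, [/\ nbrs H v = [set y1; y2; y3], [&& y1 != y2, y1 != y3 & y2 != y3],
   nbrs H y1 = [set v; p], p \notin nbrs H v & dg H y3 = 2].
  move=> Nv' ab' ac' bc' da' db' nac.
  have /andP[aH va] : (a' \in H) && adj v a' by rewrite -in_nbrs Nv' !inE eqxx.
  have /andP[bH vb] : (b' \in H) && adj v b' by rewrite -in_nbrs Nv' !inE eqxx orbT.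
  have vN : v \in nbrs H a' by rewrite in_nbrs vH adj_sym.
  have /cards1P[p Np] : #|nbrs H a' :\ v| == 1.
    by have := cardsD1 v (nbrs H a'); rewrite -/(dg H a') da' vN add1n => -[<-].
  have Na : nbrs H a' = [set v; p] by rewrite -Np setD1K.
  have pN : p \in nbrs H a' by rewrite Na !inE eqxx orbT.
  exists a', c', b', p; split=> //.
  - by rewrite Nv' setUAC.
  - by rewrite ab' ac' eq_sym bc'.
  rewrite Nv' !inE !negb_or -andbA; apply/and3P; split.
  - by apply: contraTneq pN => ->; rewrite in_nbrs adj_irr andbF.
  - apply/negP => /eqP pb; have ab_adj : adj a' b'.
      by move: pN; rewrite pb in_nbrs => /andP[].
    have Nb : nbrs H b' = [set v; a'].
      apply/esym/eqP; rewrite eqEcard -/(dg H b') db' cards2 subUset !sub1set.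
      rewrite !in_nbrs vH aH adj_sym vb adj_sym ab_adj.
      by rewrite eq_sym eq_sym adj_neq.
    apply: (closedN [set a'; b']).
    - by rewrite Nv' subsetUl.
    - by apply/set0Pn; exists a'; rewrite !inE eqxx.
    move=> x /set2P[]->; rewrite ?Na ?Nb ?pb subUset !sub1set !inE !eqxx ?orbT //.
  - by apply: contraNneq nac => <-; move: pN; rewrite in_nbrs => /andP[].
have [ac_adj|nac] := boolP (adj a c); last exact: (key a b c).
have [bc_adj|nbc] := boolP (adj b c); last first.
  apply: (key b a c) => //; last by rewrite eq_sym.
  by rewrite Nv [[set a; b]]setUC.
have /andP[aH va] : (a \in H) && adj v a by rewrite -in_nbrs Nv !inE eqxx.
have /andP[bH vb] : (b \in H) && adj v b by rewrite -in_nbrs Nv !inE eqxx orbT.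
have /andP[cH vc] : (c \in H) && adj v c by rewrite -in_nbrs Nv !inE eqxx orbT.
have N2 x : x \in H -> dg H x = 2 -> adj v x -> adj x c -> nbrs H x = [set v; c].
  move=> xH dx vx xc; apply/esym/eqP; rewrite eqEcard -/(dg H x) dx cards2.
  by rewrite subUset !sub1set !in_nbrs vH cH adj_sym vx xc (adj_neq vc).
have N3 : nbrs H c = [set v; a; b].
  apply/esym/eqP; rewrite eqEcard; apply/andP; split.
    rewrite !subUset !sub1set !in_nbrs vH aH bH adj_sym vc.
    by rewrite adj_sym ac_adj adj_sym bc_adj.
  rewrite -/(dg H c) (leq_trans (theta_dg_le3 cH)) //.
  rewrite -setUA cardsU1 cards2 ab !inE negb_or.
  by rewrite (adj_neq va) (adj_neq vb).
exfalso; apply: (closedN [set a; b; c]).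
- by rewrite Nv.
- by apply/set0Pn; exists a; rewrite !inE eqxx.
move=> x; rewrite !inE -orbA => /or3P[]/eqP->.
- by rewrite (N2 a) // subUset !sub1set !inE !eqxx !orbT.
- by rewrite (N2 b) // subUset !sub1set !inE !eqxx !orbT.
- by rewrite N3 !subUset !sub1set !inE !eqxx !orbT.
Qed.

(** At least two vertices other than [v] are not adjacent to it, and at most one of them has degree
    3; another one has degree 2. *)
Lemma theta_dsets_pair_dg3 v : v \in H -> dg H v = 3 ->
  0 < #|dsets_at v H (#|H| - 2)|.
Proof.
move=> vH dv.
have : 1 < #|(H :\: nbrs H v) :\ v|.
  have := cardsD1 v (H :\: nbrs H v); rewrite !inE vH adj_irr /=.
  by rewrite cardsD (setIidPr (nbrs_sub H v)) -/(dg H v) dv; have := H6; lia.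
case/card_gt1P => a [b [aD bD ab]].
have [x xD dx] : exists2 x, x \in (H :\: nbrs H v) :\ v & dg H x = 2.
  have [da|da] := eqVneq (dg H a) 2; first by exists a.
  have [db|db] := eqVneq (dg H b) 2; first by exists b.
  have H3 x : x \in (H :\: nbrs H v) :\ v -> dg H x != 2 -> x \in H /\ dg H x = 3.
    rewrite !inE => /and3P[_ _ xH]; split=> //.
    by have := theta_dg_ge2 xH; have := theta_dg_le3 xH; lia.
  have [aH da3] := H3 a aD da; have [bH db3] := H3 b bD db.
  case/eqP: ab; apply: (theta_dg3_uniq vH) => //.
    by move: aD; rewrite !inE eq_sym => /andP[].
  by move: bD; rewrite !inE eq_sym => /andP[].
move: xD; rewrite !inE => /and3P[xv nx xH]; rewrite xH andTb in nx.
by apply/card_gt0P; exists (H :\: nbrs H x); apply: theta_dsets_pair; rewrite // eq_sym.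
Qed.

(** [H :\ v] is connected with one edge fewer than vertices. A part with all degrees at least 2 has
    at least as many edges as vertices, against [arcs_growth]. *)
Lemma theta_acyclicD1 v : v \in H -> dg H v = 3 -> acyclic (H :\ v).
Proof.
move=> vH dv X sX X0; apply/exists_inP; apply: contraT.
rewrite negb_exists_in => /forall_inP h.
have a2 : 2 * #|X| <= arcs X by apply: arcs_ge => x xX; rewrite ltnNge h.
have := arcs_growth sX X0 (connD1 vH).
have := arcsD1 vH; rewrite arcsH dv (cardsD1 v H) vH.
move: a2; clear; lia.
Qed.

(** If [A] missed [z], then [v |: A] would have more edges than vertices inside the connected set
    [H :\ z], which has at most as many edges as vertices. *)
Lemma theta_connected_nbrs v A : v \in H -> dg H v = 3 -> connected_set A ->
  A \subset H :\ v -> nbrs H v \subset A -> A = H :\ v.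
Proof.
move=> vH dv cA sA sN; apply/eqP; apply: contraT => nA.
have pA : A \proper H :\ v by rewrite properEneq nA.
case/properP: pA => _ [z]; rewrite !inE => /andP[zv zH] zA.
have vA : v \notin A by apply/negP => /(subsetP sA); rewrite !inE eqxx.
have dA : 3 <= dg A v.
  rewrite -dv; apply/subset_leq_card/subsetP => y yN.
  by move: (yN); rewrite !in_nbrs (subsetP sN) // => /andP[].
have sX : v |: A \subset H :\ z.
  rewrite subUset sub1set !inE eq_sym zv vH /=.
  apply/subsetP => y yA; rewrite !inE; move/(subsetP sA): (yA).
  by rewrite !inE => /andP[_ ->]; rewrite andbT; apply: contraNneq zA => <-.
have X0 : v |: A != set0 by apply/set0Pn; exists v; rewrite setU11.
have := arcs_growth sX X0 (connD1 zH); rewrite arcsU1 // cardsU1 vA add1n.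
have := arcs_connected cA; have := arcsD1 zH; rewrite arcsH (cardsD1 z H) zH.
have := theta_dg_ge2 zH; move: dA; clear; lia.
Qed.

(** The connected sets through [y1] are split according to [y2] and [y3]. The images of the three
    maps are distinguished from each other and from the sets isolating [v] by their size and by
    whether they contain [y1] or [y3]. *)
Lemma theta_del_dg3 v k : v \in H -> dg H v = 3 ->
  #|csets (H :\ v) k.+4| <= #|dsets_at v H k.+4| + #|dsets_at v H k.+3|.
Proof.
move=> vH dv; set T := H :\ v.
have cT : #|H| = #|T|.+1 by rewrite (cardsD1 v H) vH.
have [hk|hk] := leqP #|T| k.+4.
  apply: leq_trans (csets_le _ _) _.
  move: hk; rewrite leq_eqVlt => /orP[/eqP hT|hT]; last by rewrite bin_small.
  (* Only [T] itself can be counted here, and [k.+3] is [#|H| - 2]. *)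
  have := theta_dsets_pair_dg3 vH dv.
  by rewrite cT hT binn subSS subSS subn0 => /leq_trans; apply; rewrite leq_addl.
have [y1 [y2 [y3 [p [Nv /and3P[y12 y13 y23] N1 pN d3]]]]] := theta_dg3_nbrs vH dv.
have /andP[y1H vy1] : (y1 \in H) && adj v y1 by rewrite -in_nbrs Nv !inE eqxx.
have /andP[y2H vy2] : (y2 \in H) && adj v y2 by rewrite -in_nbrs Nv !inE eqxx orbT.
have /andP[y3H vy3] : (y3 \in H) && adj v y3 by rewrite -in_nbrs Nv !inE eqxx orbT.
have y1T : y1 \in T by rewrite !inE y1H andbT eq_sym adj_neq.
have y3T : y3 \in T by rewrite !inE y3H andbT eq_sym adj_neq.
have NT y q : y \in H -> nbrs H y = [set v; q] -> nbrs T y = [set q].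
  move=> yH Ny; have := theta_dg_ge2 yH; rewrite /dg Ny cards2.
  case: (v =P q) => // vq _; apply/setP => z.
  rewrite in_nbrs !inE -andbA -in_nbrs Ny !inE.
  by case: (z =P v) => //= ->; apply/esym/eqP.
have [r N3] : exists r, nbrs H y3 = [set v; r].
  have vN : v \in nbrs H y3 by rewrite in_nbrs vH adj_sym.
  have /cards1P[r Nr] : #|nbrs H y3 :\ v| == 1.
    by have := cardsD1 v (nbrs H y3); rewrite -/(dg H y3) d3 vN add1n => -[<-].
  by exists r; rewrite -Nr setD1K.
have r1 : r != y1.
  apply: contraNneq pN => r1; have : y3 \in nbrs H y1.
    rewrite in_nbrs y3H adj_sym; have : r \in nbrs H y3 by rewrite N3 !inE eqxx orbT.
    by rewrite r1 in_nbrs => /andP[].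
  rewrite N1 !inE => /orP[/eqP y3v|/eqP<-]; last by rewrite y3H.
  by move: vy3; rewrite y3v adj_irr.
have y1p : y1 != p.
  by apply: adj_neq; have : p \in nbrs H y1; [rewrite N1 !inE eqxx orbT|rewrite in_nbrs => /andP[]].
have y3r : y3 != r.
  by apply: adj_neq; have : r \in nbrs H y3; [rewrite N3 !inE eqxx orbT|rewrite in_nbrs => /andP[]].
have y2p : y2 != p by apply: contraNneq pN => <-; rewrite in_nbrs y2H.
have NT1 := NT _ _ y1H N1; have NT3 := NT _ _ y3H N3.
have mp A : A \in csets_at y1 T k.+4 -> p \in A by apply: csets_at_nbr.
have mr A : A \in csets_at y1 T k.+4 -> y3 \in A -> r \in A.
  move=> hA y3A; apply: (csets_at_nbr NT3 (k := k.+2)).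
  move: hA; rewrite !in_csets_at => /and4P[-> -> -> _]; by rewrite y3A.
have m23 A : A \in csets_at y1 T k.+4 -> y3 \in A -> y2 \notin A.
  rewrite in_csets_at => /and4P[sA /eqP cA nA y1A] y3A; apply/negP => y2A.
  have AT : A = T.
    apply: (theta_connected_nbrs vH dv nA sA).
    by rewrite Nv !subUset !sub1set y1A y2A y3A.
  by move: hk; rewrite -AT cA ltnn.
(* [y1] is the only neighbour of [v] in [A]; exchanging [p] for [v] makes [v] and [y1] a
   component. *)
have e1 : #|[set A in csets_at y1 T k.+4 | (y3 \notin A) && (y2 \notin A)]| <=
          #|[set B in dsets_at v H k.+4 | y1 \in B]|.
  apply: (leq_card_inj (f := fun A => v |: (A :\ p))) => [A B|A]; rewrite inE.
    case/andP=> hA _; rewrite inE => /andP[hB _] e.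
    apply: (setD1_inj (mp _ hA) (mp _ hB)); apply: setU1_inj e.
      move: hA; rewrite in_csets_at => /and4P[/subsetD1P[_ vA] _ _ _].
      by rewrite !inE negb_and vA orbT.
    move: hB; rewrite in_csets_at => /and4P[/subsetD1P[_ vB] _ _ _].
    by rewrite !inE negb_and vB orbT.
  case/andP=> hA /andP[y3A y2A]; have pA := mp A hA.
  move: hA; rewrite in_csets_at => /and4P[/subsetD1P[sA vA] /eqP cA nA y1A].
  have vB : v \notin A :\ p by rewrite !inE negb_and vA orbT.
  have y1B : y1 \in v |: (A :\ p) by rewrite !inE y1p y1A orbT.
  rewrite inE y1B andbT; apply: (dsets_edge (y := y1)) => //; rewrite ?setU11 //.
  - by rewrite subUset sub1set vH (subset_trans (subD1set _ _) sA).
  - by rewrite cardsU1 vB -cA (cardsD1 p A) pA.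
  - move=> z; rewrite !inE => /orP[/eqP->|/andP[_ zA]] vz; first by rewrite adj_irr in vz.
    have : z \in nbrs H v by rewrite in_nbrs (subsetP sA).
    by rewrite Nv !inE -orbA => /or3P[]/eqP ez //; rewrite -ez zA in y2A y3A.
  - move=> z; rewrite !inE => /orP[/eqP-> //|/andP[zp zA]] yz.
    have : z \in nbrs H y1 by rewrite in_nbrs (subsetP sA).
    by rewrite N1 !inE (negPf zp) orbF => /eqP.
(* To leave [y1] as the only neighbour of [v], [y2] is dropped too, so the size decreases by one. *)
have e2 : #|[set A in csets_at y1 T k.+4 | (y3 \notin A) && (y2 \in A)]| <=
          #|[set B in dsets_at v H k.+3 | y1 \in B]|.
  apply: (leq_card_inj (f := fun A => v |: (A :\ p :\ y2))) => [A B|A]; rewrite inE.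
    case/andP=> hA /andP[_ y2A]; rewrite inE => /andP[hB /andP[_ y2B]] e.
    apply: (setD1_inj (mp _ hA) (mp _ hB)).
    apply: (@setD1_inj _ y2); rewrite ?inE ?y2p //; apply: setU1_inj e.
      move: hA; rewrite in_csets_at => /and4P[/subsetD1P[_ vA] _ _ _].
      by rewrite !inE !negb_and vA !orbT.
    move: hB; rewrite in_csets_at => /and4P[/subsetD1P[_ vB] _ _ _].
    by rewrite !inE !negb_and vB !orbT.
  case/andP=> hA /andP[y3A y2A]; have pA := mp A hA.
  move: hA; rewrite in_csets_at => /and4P[/subsetD1P[sA vA] /eqP cA nA y1A].
  have vB : v \notin A :\ p :\ y2 by rewrite !inE !negb_and vA !orbT.
  have y2B : y2 \in A :\ p by rewrite !inE y2p.
  have y1B : y1 \in v |: (A :\ p :\ y2) by rewrite !inE y1p y12 y1A orbT.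
  rewrite inE y1B andbT; apply: (dsets_edge (y := y1)) => //; rewrite ?setU11 //.
  - rewrite subUset sub1set vH.
    by rewrite (subset_trans (subD1set _ _)) // (subset_trans (subD1set _ _) sA).
  - by rewrite cardsU1 vB; move: cA; rewrite (cardsD1 p A) pA (cardsD1 y2) y2B !add1n => -[->].
  - move=> z; rewrite !inE => /orP[/eqP->|/and3P[zy2 _ zA]] vz.
      by rewrite adj_irr in vz.
    have : z \in nbrs H v by rewrite in_nbrs (subsetP sA).
    rewrite Nv !inE (negPf zy2) orbF => /orP[/eqP//|/eqP ez].
    by rewrite -ez zA in y3A.
  - move=> z; rewrite !inE => /orP[/eqP-> //|/and3P[_ zp zA]] yz.
    have : z \in nbrs H y1 by rewrite in_nbrs (subsetP sA).
    by rewrite N1 !inE (negPf zp) orbF => /eqP.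
(* The component becomes [v] and [y3]: [y1] and [r] are removed, and [y2] is absent by [m23]. *)
have e3 : #|[set A in csets_at y1 T k.+4 | y3 \in A]| <=
          #|[set B in dsets_at v H k.+3 | (y1 \notin B) && (y3 \in B)]|.
  apply: (leq_card_inj (f := fun A => v |: (A :\ y1 :\ r))) => [A B|A]; rewrite inE.
    case/andP=> hA y3A; rewrite inE => /andP[hB y3B] e.
    have rA := mr A hA y3A; have rB := mr B hB y3B.
    move: hA hB; rewrite !in_csets_at.
    move=> /and4P[/subsetD1P[_ vA] _ _ y1A] /and4P[/subsetD1P[_ vB] _ _ y1B].
    apply: (setD1_inj y1A y1B); apply: (@setD1_inj _ r); rewrite ?inE ?r1 //.
    by apply: setU1_inj e; rewrite !inE !negb_and ?vA ?vB !orbT.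
  case/andP=> hA y3A; have rA := mr A hA y3A; have y2A := m23 A hA y3A.
  move: hA; rewrite in_csets_at => /and4P[/subsetD1P[sA vA] /eqP cA nA y1A].
  have vB : v \notin A :\ y1 :\ r by rewrite !inE !negb_and vA !orbT.
  have rB : r \in A :\ y1 by rewrite !inE r1.
  have y3B : y3 \in v |: (A :\ y1 :\ r) by rewrite !inE y3r y3A (eq_sym y3 y1) y13 orbT.
  have y1B : y1 \notin v |: (A :\ y1 :\ r).
    by rewrite !inE eqxx andbF orbF (eq_sym y1) (adj_neq vy1).
  rewrite inE y3B y1B !andbT; apply: (dsets_edge (y := y3)) => //; rewrite ?setU11 //.
  - rewrite subUset sub1set vH.
    by rewrite (subset_trans (subD1set _ _)) // (subset_trans (subD1set _ _) sA).
  - by rewrite cardsU1 vB; move: cA; rewrite (cardsD1 y1 A) y1A (cardsD1 r) rB !add1n => -[->].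
  - move=> z; rewrite !inE => /orP[/eqP->|/and3P[_ zy1 zA]] vz.
      by rewrite adj_irr in vz.
    have : z \in nbrs H v by rewrite in_nbrs (subsetP sA).
    rewrite Nv !inE (negPf zy1) /= => /orP[/eqP ez|/eqP//].
    by rewrite -ez zA in y2A.
  - move=> z; rewrite !inE => /orP[/eqP-> //|/and3P[zr _ zA]] yz.
    have : z \in nbrs H y3 by rewrite in_nbrs (subsetP sA).
    by rewrite N3 !inE (negPf zr) orbF => /eqP.
have acT : acyclic (T :\ y1).
  move=> X sX; apply: (theta_acyclicD1 vH dv).
  exact: subset_trans sX (subD1set _ _).
(* Pascal's rule splits the bound for the forest [T :\ y1] into the counts of sets isolating [v] in
   the two sizes. *)
have e0 := csets_acyclic k.+2 acT.
have i4 := dsets_isolated k.+2 vH; have i3 := dsets_isolated k.+1 vH.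
have cTy : #|T| = #|T :\ y1|.+1 by rewrite (cardsD1 y1 T) y1T.
have ce : #|T :\ y1|.-1 = (#|H| - (dg H v).+1).+1.
  by rewrite dv cT cTy; move: hk; rewrite cTy; clear; lia.
rewrite ce binS in e0.
have y1N (B : {set G}) : [disjoint nbrs H v & B] -> (y1 \notin B) && (y3 \notin B).
  move=> dB; apply/andP; split; apply/negbT/(disjointFr dB).
    by rewrite in_nbrs y1H.
  by rewrite in_nbrs y3H.
have d4 : #|[set B in dsets_at v H k.+4 | y1 \in B]| +
          #|[set B in dsets_at v H k.+4 | [disjoint nbrs H v & B]]| <= #|dsets_at v H k.+4|.
  rewrite (card_setI_split (dsets_at _ _ _) (fun B => y1 \in B)) leq_add2l.
  apply/subset_leq_card/subsetP => B; rewrite !inE => /andP[-> /y1N/andP[-> _]].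
  by [].
have d3' : #|[set B in dsets_at v H k.+3 | y1 \in B]| +
     (#|[set B in dsets_at v H k.+3 | (y1 \notin B) && (y3 \in B)]| +
      #|[set B in dsets_at v H k.+3 | [disjoint nbrs H v & B]]|) <= #|dsets_at v H k.+3|.
  rewrite (card_setI_split (dsets_at _ _ _) (fun B => y1 \in B)) leq_add2l.
  rewrite (card_setI_split [set B in dsets_at _ _ _ | y1 \notin B] (fun B => y3 \in B)).
  apply: leq_add; apply/subset_leq_card/subsetP => B; rewrite !inE.
    by case/andP=> -> /andP[-> ->].
  by case/andP=> -> /y1N/andP[-> ->].
have s3 : #|csets_at y1 T k.+4| =
    #|[set A in csets_at y1 T k.+4 | y3 \in A]| +
    (#|[set A in csets_at y1 T k.+4 | (y3 \notin A) && (y2 \in A)]| +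
     #|[set A in csets_at y1 T k.+4 | (y3 \notin A) && (y2 \notin A)]|).
  rewrite (card_setI_split (csets_at _ _ _) (fun A => y3 \in A)); congr (_ + _).
  rewrite (card_setI_split [set A in csets_at _ _ _ | y3 \notin A] (fun A => y2 \in A)).
  by congr (_ + _); apply: eq_card => A; rewrite !inE !andbA.
rewrite (csets_split _ y1T) s3.
move: e0 e1 e2 e3 i3 i4 d4 d3'; clear; lia.
Qed.

End Theta.

(** * Adding pendant vertices *)

Section Assembly.
Variable G : sgraph.
Implicit Types (A B H X Y T : {set G}) (x y z v : G).

Lemma csets_at_2 v A : #|csets_at v A 2| <= dg A v.
Proof.
apply: leq_trans (leq_imset_card (fun y => [set v; y]) _).
apply/subset_leq_card/subsetP => B; rewrite in_csets_at => /and4P[sB /eqP cB nB vB].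
have /card_gt0P[y] := dg_gt0 nB vB ltac:(by rewrite cB).
rewrite in_nbrs => /andP[yB vy]; apply/imsetP; exists y.
  by rewrite in_nbrs vy (subsetP sB).
apply/esym/eqP; rewrite eqEcard cB cards2 (adj_neq vy) andbT.
by rewrite subUset !sub1set vB yB.
Qed.

(** The value that [S_B_ge3] guarantees for [B n]. Sizes are shifted by 3, since sizes 1 and 2 are
    compared separately. *)
Definition csets_bound A :=
  forall k, #|csets A k.+3| <= 'C(#|A|.-1, k.+2) + (k == 0).

Lemma csets_boundU1 A x y : x \notin A -> y \in A -> nbrs (x |: A) x = [set y] ->
  csets_bound A -> csets_bound (x |: A).
Proof.
move=> xA yA Nx bA k; apply: leq_trans (csets_pendant _ (setU11 x A) Nx) _ => //.
rewrite setU1K // cardsU1 xA add1n succnK.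
have -> : #|A| = #|A|.-1.+1 by rewrite (cardsD1 y A) yA.
rewrite binS addnAC; apply: leq_add (bA k) _.
exact: csets_at_le.
Qed.

Hypothesis connG : connected_set [set: G].
Hypothesis arcsG : arcs [set: G] <= (#|G|.+1).*2.

(** The excess of edges over vertices is already that of the whole graph and cannot grow, so a
    vertex adjacent to [A] has just one neighbour in it. *)
Lemma exists_pendant A : A != set0 -> A != setT -> (#|A|.+1).*2 <= arcs A ->
  exists x y, [/\ x \notin A, y \in A, nbrs (x |: A) x = [set y]
                & (#|x |: A|.+1).*2 <= arcs (x |: A)].
Proof.
move=> A0 AT aA.
have [y [x [yA _ xA yx]]] := connected_set_cut connG (subsetT A) A0 AT.
have d1 : 0 < dg A x by apply/card_gt0P; exists y; rewrite in_nbrs yA adj_sym.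
have U0 : x |: A != set0 by apply/set0Pn; exists x; rewrite setU11.
have g := arcs_growth (subsetT _) U0 connG.
have a1 := arcsU1 xA; have c1 : #|x |: A| = #|A|.+1 by rewrite cardsU1 xA.
rewrite cardsT in g.
have dx : dg A x = 1 by move: g arcsG aA d1; rewrite a1 c1; clear; lia.
exists x, y; split=> //; last by rewrite a1 c1 dx; move: aA; clear; lia.
apply/esym/eqP; rewrite eqEcard -/(dg _ _) dgU1 // adj_irr dx cards1 andbT.
by rewrite sub1set in_nbrs !inE yA orbT adj_sym.
Qed.

Lemma csets_bound_growth A : A != set0 -> (#|A|.+1).*2 <= arcs A ->
  csets_bound A -> csets_bound [set: G].
Proof.
have [n] := ubnP (#|G| - #|A|); elim: n A => // n IH A hn A0 aA bA.
have [AT|AT] := eqVneq A setT; first by rewrite -AT.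
have [x [y [xA yA Nx aU]]] := exists_pendant A0 AT aA.
apply: (IH (x |: A)) => //.
- have cU : #|x |: A| <= #|G| by apply: max_card.
  by move: hn cU; rewrite cardsU1 xA; clear; lia.
- by apply/set0Pn; exists x; rewrite setU11.
- exact: (csets_boundU1 xA yA Nx).
Qed.

(** * First steps of the growth, by the order of the theta subgraph *)

Lemma csets_bound_order4 A : #|A| = 4 -> csets_bound A.
Proof.
move=> c4 [|[|k]]; apply: leq_trans (csets_le _ _) _; rewrite c4 //.
Qed.

Section Core.
Variable H : {set G}.
Hypothesis H4 : 3 < #|H|.
Hypothesis connD1 : forall z, z \in H -> connected_set (H :\ z).
Hypothesis arcsH : arcs H = (#|H|.+1).*2.

Lemma csets_bound_theta_leaf x y : 5 < #|H| -> x \notin H -> y \in H ->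
  nbrs (x |: H) x = [set y] -> csets_bound (x |: H).
Proof.
move=> H6 xH yH Nx k; apply: leq_trans (csets_pendant _ (setU11 x H) Nx) _ => //.
rewrite setU1K // cardsU1 xH add1n succnK.
have d3 : dg H y <= 3 by apply: theta_dg_le3.
case: k => [|k].
  have h3 : #|csets H 3| <= #|H| + 4 by apply: theta_csets3.
  have h2 := csets_at_2 y H; rewrite bin2.
  (* The triples of [H] and at most three edges at [y]; order 6 gives 13 against 16. *)
  have : #|H| + 7 <= (#|H| * #|H|.-1)./2 + 1.
    move: H6; clear; case: #|H| => // m hm; rewrite succnK.
    have h5 : m.+1 * 5 <= m.+1 * m by rewrite leq_mul2l.
    have : (m + 7).*2 <= m.+1 * m by apply: leq_trans h5; lia.
    by move/half_leq; rewrite doubleK; lia.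
  by move: h3 h2 d3; clear; lia.
(* Both binomials of Pascal's rule are rewritten as connected plus disconnected sets at [y], and the
   connected ones cancel. *)
have -> : #|H| = #|H|.-1.+1 by rewrite (cardsD1 y H) yH.
rewrite binS addn0 (csets_split _ yH).
rewrite -(csets_at_dsets_at k.+3 yH) -(csets_at_dsets_at k.+2 yH).
have : #|csets (H :\ y) k.+4| <= #|dsets_at y H k.+4| + #|dsets_at y H k.+3|.
  have d2 : 2 <= dg H y by apply: theta_dg_ge2.
  move: d3; rewrite leq_eqVlt => /orP[/eqP d3|d3]; first exact: theta_del_dg3.
  by apply: theta_del_dg2 => //; apply/eqP; rewrite eqn_leq -ltnS d3.
by clear; lia.
Qed.

(** [z] is where a second pendant vertex may be attached. The disconnected triple saves the one unit
    needed for size 4 in [csets_bound_order5]. *)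
Lemma dsets_order5_leaf x y z : #|H| = 5 -> x \notin H -> y \in H ->
  nbrs (x |: H) x = [set y] -> z \in x |: H -> dg (x |: H) z <= 4 /\ 0 < #|dsets_at z (x |: H) 3|.
Proof.
move=> H5 xH yH Nx zA; set A := x |: H.
have cA : #|A| = 6 by rewrite cardsU1 xH H5.
have [d3|d3] := leqP (dg A z) 3.
  split; first exact: leqW.
  apply: leq_trans (leq_trans _ (dsets_isolated 1 zA)) _.
    by rewrite -/A cA bin_gt0; move: d3; clear; lia.
  by apply/subset_leq_card/subsetP => B; rewrite inE => /andP[].
have zx : z != x.
  by apply: contraTneq d3 => ->; rewrite /dg Nx cards1.
have zH : z \in H by move: zA; rewrite !inE (negPf zx).
have dz := dgU1 z xH; have dz3 : dg H z <= 3 by apply: theta_dg_le3.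
have xz : adj x z by move: d3; rewrite dz; case: (adj x z) dz3 => //; clear; lia.
have d4 : dg A z = 4 by move: d3 dz3; rewrite dz xz; clear; lia.
split; first by rewrite d4.
(* Degree 4 occurs only at the vertex carrying the leaf [x]. A single vertex [t] is then not
   adjacent to [z], and in the triple [z], [x], [t] it is cut off. *)
have ey : z = y.
  by apply/set1P; rewrite -Nx in_nbrs zA xz.
have zD : z \in A :\: nbrs A z by rewrite in_setD in_nbrs adj_irr andbF zA.
have /card_gt0P[t] : 0 < #|(A :\: nbrs A z) :\ z|.
  have := cardsD1 z (A :\: nbrs A z); rewrite zD cardsD (setIidPr (nbrs_sub _ _)).
  by rewrite -/(dg A z) d4 cA; clear; lia.
rewrite in_setD1 in_setD in_nbrs => /and3P[tz nzt tA]; rewrite tA andTb in nzt.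
have tx : t != x by apply: contraNneq nzt => ->; rewrite adj_sym.
apply/card_gt0P; exists [set z; x; t]; apply: (dsets_edge (y := x)).
- by rewrite !subUset !sub1set zA setU11 tA.
- by rewrite setUC cardsU1 cards2 zx !inE (negPf tz) (negPf tx).
- by rewrite !inE eqxx.
- by rewrite !inE eqxx orbT.
- move=> w; rewrite !inE -orbA => /or3P[]/eqP-> //; first by rewrite adj_irr.
  by rewrite (negPf nzt).
- move=> w wB xw; have : w \in nbrs A x.
    rewrite in_nbrs xw andbT; move: wB; rewrite in_setU in_set2 in_set1.
    by case/orP=> [/orP[]|] /eqP-> //; apply: setU11.
  by rewrite Nx ey => /set1P.
Qed.

(** Adding the sets of [H], those through [x] and those through [x'] gives 9 + 3 + 4 = 16, 5 + 6 + 9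
    = 20, 1 + 4 + 10 = 15 and 0 + 1 + 5 = 6 for sizes 3 to 6, exactly the bound at order 7. *)
Lemma csets_bound_order5 x y x' y' : #|H| = 5 -> x \notin H -> y \in H ->
    nbrs (x |: H) x = [set y] -> x' \notin x |: H -> y' \in x |: H ->
    nbrs (x' |: (x |: H)) x' = [set y'] ->
  csets_bound (x' |: (x |: H)).
Proof.
move=> H5 xH yH Nx x'A y'A Nx' k; set A := x |: H.
have cA : #|A| = 6 by rewrite cardsU1 xH H5.
have p1 : #|csets A k.+3| <= #|csets H k.+3| + #|csets_at y H k.+2|.
  by have := csets_pendant (k := k.+2) isT (setU11 x H) Nx; rewrite setU1K.
have p2 : #|csets (x' |: A) k.+3| <= #|csets A k.+3| + #|csets_at y' A k.+2|.
  by have := csets_pendant (k := k.+2) isT (setU11 x' A) Nx'; rewrite setU1K.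
have -> : #|x' |: A| = 7 by rewrite cardsU1 x'A cA.
apply: leq_trans p2 _; apply: leq_trans (leq_add p1 (leqnn _)) _.
have [d4 n3] := dsets_order5_leaf H5 xH yH Nx y'A; rewrite -/A in d4 n3.
have b1 := csets_le H k.+3; rewrite H5 in b1.
have b2 := csets_at_le k.+1 yH; rewrite H5 in b2.
have b3 := csets_at_dsets_at k.+1 y'A; rewrite -/A cA in b3.
have d3 : dg H y <= 3 by apply: theta_dg_le3.
case: k b1 b2 b3 {p1} => [|[|[|[|k]]]].
- move=> _ _ _; have h3 : #|csets H 3| <= #|H| + 4 by apply: theta_csets3.
  have := csets_at_2 y H; have := csets_at_2 y' A.
  rewrite H5 in h3; have -> : 'C(7.-1, 2) = 15 by [].
  by move: h3 d3 d4; clear; lia.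
- move=> b1 b2 b3.
  have {}b1 : #|csets H 4| <= 5 by exact: b1.
  have {}b2 : #|csets_at y H 3| <= 6 by exact: b2.
  have {}b3 : #|csets_at y' A 3| + #|dsets_at y' A 3| = 10 by exact: b3.
  have -> : 'C(7.-1, 3) = 20 by [].
  by move: b1 b2 b3 n3; clear; lia.
- have -> : 'C(5, 5) = 1 by []. have -> : 'C(5.-1, 3) = 4 by [].
  by have -> : 'C(6.-1, 3) = 10 by []; have -> : 'C(7.-1, 4) = 15 by []; clear; lia.
- have -> : 'C(5, 6) = 0 by []. have -> : 'C(5.-1, 4) = 1 by [].
  by have -> : 'C(6.-1, 4) = 5 by []; have -> : 'C(7.-1, 5) = 6 by []; clear; lia.
- rewrite [5.-1]/= [6.-1]/= [7.-1]/= (binS 5 k.+1.+4).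
  rewrite (@bin_small 5 k.+3.+4) // (@bin_small 4) // => b1 b2 b3; move: b1 b2 b3.
  by clear; lia.
Qed.

End Core.

Lemma csets_bound_core H : 6 < #|G| -> 3 < #|H| -> H != setT ->
    (forall z, z \in H -> connected_set (H :\ z)) -> (#|H|.+1).*2 <= arcs H ->
  csets_bound [set: G].
Proof.
move=> G7 H4 HT cH aH.
have H0 : H != set0 by rewrite -card_gt0; apply: leq_trans H4.
have arcsH : arcs H = (#|H|.+1).*2.
  have := arcs_growth (subsetT _) H0 connG; rewrite cardsT.
  by move: arcsG aH; clear; lia.
have U0 x A : x |: A != set0 by apply/set0Pn; exists x; rewrite setU11.
have [c4|c4] := eqVneq #|H| 4; first exact: csets_bound_growth (csets_bound_order4 c4).
have [x [y [xH yH Nx aU]]] := exists_pendant H0 HT aH.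
have [c5|c5] := eqVneq #|H| 5; last first.
  apply: (csets_bound_growth (U0 x H) aU).
  by apply: csets_bound_theta_leaf Nx => //; move: H4 c4 c5; clear; lia.
have UT : x |: H != setT.
  apply: contraTneq G7 => e; have := cardsT G; rewrite -e cardsU1 xH c5 => <-.
  by [].
have [x' [y' [x'U y'U Nx' aU']]] := exists_pendant (U0 x H) UT aU.
apply: (csets_bound_growth (U0 x' _) aU').
exact: csets_bound_order5 Nx x'U y'U Nx'.
Qed.

End Assembly.

(** * The graphs G3 *)

(** Allows connectivity to be proved by propagating a label along edges. The label used is
    membership in a part that no edge leaves. *)
Lemma connected_set_const (G : sgraph) (A : {set G}) : A != set0 ->
    (forall P : pred G, {in A &, forall x y, adj x y -> P x = P y} ->
       {in A &, forall x y, P x = P y}) ->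
  connected_set A.
Proof.
move=> A0 h; apply: connected_setI => // B sB B0 nB.
case: (boolP [exists x in B, [exists y in A :\: B, adj x y]]).
  case/exists_inP => x xB /exists_inP[y]; rewrite inE => /andP[yB yA] xy.
  by exists x, y.
rewrite negb_exists_in => /forall_inP hB.
have cl x y : x \in B -> y \in A -> adj x y -> y \in B.
  move=> xB yA xy; apply: contraT => yB; have := hB x xB.
  by rewrite negb_exists_in => /forall_inP/(_ y); rewrite inE yB yA xy => /(_ isT).
have /set0Pn[x xB] := B0.
have /subsetPn[y yA yB] : ~~ (A \subset B).
  by apply: contra nB => s; rewrite eqEsubset sB.
have := h (mem B) _ x y (subsetP sB _ xB) yA; rewrite /= xB (negPf yB) => H.
suff : true = false by [].
apply: H => u w uA wA uw; apply/idP/idP => [uB|wB]; first exact: cl uw.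
by apply: cl wB uA _; rewrite adj_sym.
Qed.

Section ThetaGraph.
Variables a b c : nat.
Local Notation len := (theta_len a b c).
Local Notation V := (G3 a b c).

(** Inverse of [theta_pos] on path [p]. Past the internal vertices [insub] fails and the default is
    the second end, as wanted at position [(len p).+1]. *)
Definition path_vertex (p : 'I_3) (i : nat) : V :=
  if i is j.+1 then
    if @insub nat (fun k => k < len p) 'I_(len p) j is Some k
    then inr (Tagged (fun p => 'I_(len p)) k) else inl true
  else inl false.

Lemma path_vertexS_lt p (k : 'I_(len p)) :
  path_vertex p k.+1 = inr (Tagged (fun p => 'I_(len p)) k).
Proof. by rewrite /path_vertex valK. Qed.

Lemma path_vertex_end p : path_vertex p (len p).+1 = inl true.
Proof. by rewrite /path_vertex insubN // ltnn. Qed.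

Lemma theta_pos_path_vertex p i : i <= (len p).+1 ->
  theta_pos p (path_vertex p i) = Some i.
Proof.
case: i => [//|i]; rewrite ltnS leq_eqVlt => /orP[/eqP->|lt].
  by rewrite path_vertex_end.
by rewrite (path_vertexS_lt (Ordinal lt)) /= eqxx.
Qed.

Lemma path_vertex_adj p i : i <= len p ->
  @adj V (path_vertex p i) (path_vertex p i.+1).
Proof.
move=> le; apply/existsP; exists p.
by rewrite !theta_pos_path_vertex ?eqxx //; apply: leqW.
Qed.

Lemma path_vertex_inj p i j : i <= (len p).+1 -> j <= (len p).+1 ->
  path_vertex p i = path_vertex p j -> i = j.
Proof.
move=> hi hj e; have := theta_pos_path_vertex hi.
by rewrite e theta_pos_path_vertex // => -[].
Qed.

Lemma path_vertexP (u : V) : exists p i, i <= (len p).+1 /\ u = path_vertex p i.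
Proof.
case: u => [[]|[p k]].
- by exists ord0, (len ord0).+1; rewrite path_vertex_end.
- by exists ord0, 0.
by exists p, k.+1; rewrite path_vertexS_lt ltnS ltnW.
Qed.

(** From any vertex one walks along its path, away from [z], to an end. If both ends remain, a path
    without [z] joins them. *)
Lemma G3_connectedD1 (z : V) : connected_set ([set: V] :\ z).
Proof.
apply: connected_set_const.
  apply/set0Pn; exists (if z == inl true then inl false else inl true).
  by rewrite !inE andbT; case: ifP => [/eqP->//|]; rewrite eq_sym => ->.
move=> P hP.
have step p i : i <= len p -> path_vertex p i != z -> path_vertex p i.+1 != z ->
    P (path_vertex p i) = P (path_vertex p i.+1).
  by move=> le ni ni1; apply: hP; rewrite ?inE ?andbT //; apply: path_vertex_adj.
have up p i : i <= (len p).+1 -> (forall j, j <= i -> path_vertex p j != z) ->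
    P (path_vertex p i) = P (inl false).
  elim: i => [//|i IH] le h; rewrite -step ?h //.
  by apply: IH => [|j le_ji]; [apply: ltnW | apply: h; apply: leqW].
have down p d : d <= (len p).+1 ->
    (forall j, (len p).+1 - d <= j -> j <= (len p).+1 -> path_vertex p j != z) ->
    P (path_vertex p ((len p).+1 - d)) = P (inl true).
  elim: d => [|d IH] le h; first by rewrite subn0 path_vertex_end.
  have e : (len p).+1 - d = ((len p).+1 - d.+1).+1 by rewrite -subSn // subSS.
  rewrite step; last 2 first.
  - by apply: h => //; apply: leq_subr.
  - by apply: h; rewrite -?e ?leq_subr // leq_sub2l.
  - rewrite -e; apply: IH; first exact: ltnW.
    by move=> j hj; apply: h; apply: leq_trans hj; apply: leq_sub2l.
  by rewrite subSS leq_subr.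
have ends : inl false != z -> inl true != z -> P (inl false) = P (inl true).
  case: z {hP step down} up => [[]//|q] up _ _.
  have [p pq] : exists p : 'I_3, p != tag q.
    by exists (if tag q == ord0 then ord_max else ord0); case: (tag q) => -[|[|[|]]].
  rewrite -(path_vertex_end p) up // => j.
  rewrite leq_eqVlt => /orP[/eqP->|]; first by rewrite path_vertex_end.
  case: j => [//|j]; rewrite ltnS => lt; rewrite (path_vertexS_lt (Ordinal lt)).
  by apply: contraNneq pq => -[<-].
suff main u : u != z -> P u = P (if inl false == z then inl true else inl false).
  by move=> u w; rewrite !inE !andbT => uz wz; rewrite main // (main w).
case: (path_vertexP u) => p [i [hi ->]] iz.
case: (boolP [exists j : 'I_(len p).+2, path_vertex p j == z]) => [|nz]; last first.
  have h j : j <= (len p).+1 -> path_vertex p j != z.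
    move=> hj; apply: contraNneq nz => <-; apply/existsP.
    by exists (Ordinal (hj : j < (len p).+2)).
  by rewrite (negPf (h 0 _)) // up // => j hj; apply: h; apply: leq_trans hi.
case/existsP => -[j /= hj] /eqP ez.
have neq k : k <= (len p).+1 -> k != j -> path_vertex p k != z.
  by move=> hk; apply: contra => /eqP; rewrite -ez => /(path_vertex_inj hk hj)->.
case: (ltngtP i j) => [ij|ji|ij]; last by rewrite ij ez eqxx in iz.
  rewrite ifN; last by apply: (neq 0); rewrite // ltn_eqF // (leq_trans _ ij).
  apply: up => // k ki; apply: neq; first exact: leq_trans hi.
  by rewrite ltn_eqF // (leq_ltn_trans ki).
have -> : P (path_vertex p i) = P (inl true).
  rewrite -[i](subKn hi); apply: down; first exact: leq_subr.
  by move=> k; rewrite subKn // => ik hk; apply: neq; rewrite // gtn_eqF // (leq_trans ji).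
case: ifP => // /negbT nf; rewrite ends //.
rewrite -(path_vertex_end p); apply: neq; rewrite // gtn_eqF //.
exact: leq_trans hi.
Qed.

Hypothesis one0 : (a == 0) + (b == 0) + (c == 0) <= 1.

Lemma theta_len0_inj p q : len p = 0 -> len q = 0 -> p = q.
Proof.
move=> hp hq; apply/val_inj; move: one0 hp hq.
case: p q => [[|[|[|p]]] hp] [[|[|[|q]]] hq] //=; rewrite /theta_len /=.
all: by move=> + e1 e2; rewrite e1 e2 !eqxx; case: (_ == 0).
Qed.

(** The neighbours of the end on the three paths are distinct: two could coincide only at the other
    end, on two paths without internal vertices. *)
Lemma G3_dg_end e : 3 <= dg [set: V] (inl e).
Proof.
pose f (p : 'I_3) : V := path_vertex p (if e then len p else 1).
have injf : injective f.
  move=> p q; rewrite {}/f; case: (posnP (len p)) => [p0|p0].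
    case: (posnP (len q)) => [q0 _|q0]; first exact: theta_len0_inj.
    rewrite p0 -[len q](prednK q0); case: e => //.
      by rewrite (path_vertexS_lt (Ordinal (_ : (len q).-1 < len q))) ?prednK.
    rewrite -{1}p0 path_vertex_end.
    by rewrite (path_vertexS_lt (Ordinal q0)).
  case: (posnP (len q)) => [q0|q0].
    rewrite q0; case: e.
      have lt : (len p).-1 < len p by rewrite prednK.
      by rewrite -{1}[len p](prednK p0) (path_vertexS_lt (Ordinal lt)).
    by rewrite -{2}q0 path_vertex_end (path_vertexS_lt (Ordinal p0)).
  case: e; last by rewrite (path_vertexS_lt (Ordinal p0)) (path_vertexS_lt (Ordinal q0)) => -[].
  have ltp : (len p).-1 < len p by rewrite prednK.
  have ltq : (len q).-1 < len q by rewrite prednK.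
  rewrite -{1}[len p](prednK p0) -{1}[len q](prednK q0).
  by rewrite (path_vertexS_lt (Ordinal ltp)) (path_vertexS_lt (Ordinal ltq)) => -[].
apply: leq_trans (_ : #|codom f| <= _); first by rewrite (card_codom injf) card_ord.
apply/subset_leq_card/subsetP => u.
case/codomP => p ->; rewrite in_nbrs inE /f; case: e {injf f}; last exact: (@path_vertex_adj p 0).
by rewrite adj_sym -(path_vertex_end p); apply: path_vertex_adj.
Qed.

End ThetaGraph.

Lemma arcs_ge_deg3 (G : sgraph) (A : {set G}) x y :
    (forall z, z \in A -> 2 <= dg A z) -> x \in A -> y \in A -> x != y ->
  3 <= dg A x -> 3 <= dg A y -> (#|A|.+1).*2 <= arcs A.
Proof.
move=> d2 xA yA xy dx dy; have yD : y \in A :\ x by rewrite !inE yA eq_sym xy.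
rewrite /arcs (big_setD1 x) //= (big_setD1 y) //= (cardsD1 x A) xA (cardsD1 y) yD.
have : 2 * #|A :\ x :\ y| <= \sum_(z in A :\ x :\ y) dg A z.
  by rewrite mulnC -sum_nat_const; apply: leq_sum => z; rewrite !inE => /and3P[_ _ /d2].
by move: dx dy; clear; lia.
Qed.

(** Minimum degree 2 and the two ends of degree at least 3 force the edge count without listing
    edges. *)
Lemma G3_arcs a b c : (a == 0) + (b == 0) + (c == 0) <= 1 ->
  3 < #|G3 a b c| /\ (#|G3 a b c|.+1).*2 <= arcs [set: G3 a b c].
Proof.
move=> one0; have dF := G3_dg_end one0 false; have dT := G3_dg_end one0 true.
have V4 : 3 < #|[set: G3 a b c]|.
  by apply: leq_ltn_trans dF _; apply: dg_lt; rewrite inE.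
rewrite -cardsT; split=> //; apply: (arcs_ge_deg3 _ _ _ _ dF dT); rewrite ?inE //.
by move=> z _; apply: theta_dg_ge2; rewrite ?inE // => u _; apply: G3_connectedD1.
Qed.

(** The properties of [G3] are carried over by the isomorphism. An inequality for [arcs] suffices,
    because [G] bounds it from above. *)
Lemma theta_core (G : sgraph) : type3 G ->
  exists H : {set G}, [/\ 3 < #|H|, (#|H|.+1).*2 <= arcs H
    & forall z, z \in H -> connected_set (H :\ z)].
Proof.
case=> _ [a [b [c [one0 [A [f [g fK gK] fadj]]]]]].
have [V4 aV] := G3_arcs one0.
pose h u : G := val (g u).
have hA u : h u \in A by apply: valP.
have h_inj : injective h by move=> u v /val_inj/(can_inj gK).
have hadj u v : adj (h u) (h v) = adj u v.
  by rewrite -[in RHS](gK u) -[in RHS](gK v) fadj.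
have hP x : x \in A -> exists u, x = h u.
  by move=> xA; exists (f (Sub x xA)); rewrite /h fK SubK.
have AE : A = h @: [set: G3 a b c].
  apply/setP => x; apply/idP/imsetP => [/hP[u ->]|[u _ ->]]; last exact: hA.
  by exists u.
have cA : #|A| = #|G3 a b c| by rewrite AE card_imset // cardsT.
have dA u : dg A (h u) = dg [set: G3 a b c] u.
  rewrite /dg -(card_imset _ h_inj); apply: eq_card => x.
  rewrite in_nbrs; apply/andP/imsetP => [[/hP[w ->]]|[w]].
    by rewrite hadj => uw; exists w; rewrite // in_nbrs inE.
  by rewrite in_nbrs inE => uw ->; rewrite hadj.
exists A; split; first by rewrite cA.
  rewrite cA (leq_trans aV) //.
  have -> : arcs A = \sum_(x in h @: [set: G3 a b c]) dg A x by rewrite -AE.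
  rewrite big_imset /=; last by move=> u v _ _ /h_inj.
  by apply: leq_sum => u _; rewrite dA.
move=> _ /hP[w ->]; apply: connected_set_const => [|P hPP].
  have /set0Pn[u] := connected_set_neq0 (G3_connectedD1 w).
  rewrite !inE andbT => uw; apply/set0Pn; exists (h u).
  by rewrite !inE hA andbT (inj_eq h_inj).
move=> x y; rewrite !inE => /andP[+ /hP[u eu]] /andP[+ /hP[v ev]].
rewrite eu ev !(inj_eq h_inj) => uw vw.
have cut := G3_connectedD1 w.
have [//|neq] := eqVneq (P (h u)) (P (h v)).
pose B := [set t in [set: G3 a b c] :\ w | P (h t) == P (h u)].
case: (connected_set_cut cut (B := B)) => [| | |s [t [sB tw tB st]]].
- by apply/subsetP => t; rewrite inE => /andP[].
- by apply/set0Pn; exists u; rewrite !inE uw eqxx.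
- by apply/eqP => /setP/(_ v); rewrite !inE vw /= eq_sym (negPf neq).
move: sB tB; rewrite inE => /andP[sw /eqP es]; rewrite inE tw /= -es.
rewrite (hPP (h s) (h t)) ?eqxx ?hadj // !inE hA (inj_eq h_inj) andbT.
  by move: sw; rewrite !inE andbT.
by move: tw; rewrite !inE andbT.
Qed.

(** * Edge counts and the coefficients of [CS] *)

Lemma connected_setT (G : sgraph) : connected G -> connected_set [set: G].
Proof.
case/andP=> G0 /forallP h; apply: connected_set_const => [|P hP x y _ _].
  by rewrite -card_gt0 cardsT.
have cl : closed (@adj G) P by move=> u v uv; apply: hP; rewrite ?inE.
exact: closed_connect cl _ _ (forallP (h x) y).
Qed.

(** Arcs are ordered adjacent pairs; each is recovered from its edge and one bit of orientation. *)
Lemma arcs_edges (G : sgraph) : arcs [set: G] <= 2 * #|edges G|.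
Proof.
have -> : arcs [set: G] = #|[set p : G * G | adj p.1 p.2]|.
  rewrite /arcs -sum1_card (eq_bigl (fun p : G * G => adj p.1 p.2)); last first.
    by move=> p; rewrite inE.
  rewrite -(pair_big_dep predT (fun x y => adj x y) (fun _ _ => 1)) /=.
  rewrite big_mkcond /=; apply: eq_bigr => x _; rewrite inE /dg -sum1_card.
  by apply: eq_bigl => y; rewrite !inE.
have -> : 2 * #|edges G| = #|setX (edges G) [set: bool]|.
  by rewrite cardsX cardsT card_bool mulnC.
pose f (p : G * G) := ([set p.1; p.2], enum_rank p.1 < enum_rank p.2).
apply: (leq_card_inj (f := f)) => [[x y] [x' y']|p]; last first.
  by rewrite inE => xy; rewrite in_setX in_setT andbT; apply/imsetP; exists p; rewrite ?inE.
rewrite !inE /=.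
move=> xy xy' [e lt].
have nxy := adj_neq xy.
have : x \in [set x'; y'] by rewrite -e !inE eqxx.
have : y \in [set x'; y'] by rewrite -e !inE eqxx orbT.
rewrite !inE => /orP[]/eqP ey /orP[]/eqP ex.
- by rewrite ex ey eqxx in nxy.
- move: lt nxy; rewrite ex ey; case: ltngtP => // /ord_inj/enum_rank_inj->.
  by rewrite eqxx.
- by rewrite ex ey.
- by rewrite ex ey eqxx in nxy.
Qed.

Lemma S_csets (G : sgraph) k : S_ G k = #|csets [set: G] k|.
Proof. by apply: eq_card => A; rewrite !inE subsetT andbC. Qed.

Lemma S_0 (G : sgraph) : S_ G 0 = 0.
Proof.
apply/eqP; rewrite cards_eq0; apply/eqP/setP => A; rewrite !inE.
apply/negP => /andP[/connected_set_neq0 A0]; by rewrite cards_eq0 (negPf A0).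
Qed.

Lemma S_1 (G : sgraph) : S_ G 1 = #|G|.
Proof.
apply/eqP; rewrite eqn_leq; apply/andP; split.
  by rewrite S_csets (leq_trans (csets_le _ _)) // bin1 cardsT.
rewrite -cardsT; apply: (leq_card_inj (f := set1)) => [x y _ _ /set1_inj//|x _].
rewrite inE cards1 eqxx andbT; apply: connected_set_const.
  by apply/set0Pn; exists x; rewrite inE.
by move=> P _ y z /set1P-> /set1P->.
Qed.

Lemma S_2_edges (G : sgraph) : S_ G 2 <= #|edges G|.
Proof.
apply/subset_leq_card/subsetP => B; rewrite inE => /andP[nB /eqP cB].
have /set0Pn[x xB] := connected_set_neq0 nB.
have /card_gt0P[y] := dg_gt0 nB xB ltac:(by rewrite cB).
rewrite in_nbrs => /andP[yB xy]; apply/imsetP; exists (x, y); rewrite ?inE //=.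
apply/esym/eqP; rewrite eqEcard cB cards2 (adj_neq xy) andbT.
by rewrite subUset !sub1set xB yB.
Qed.

Lemma S_gt (G : sgraph) k : #|G| < k -> S_ G k = 0.
Proof.
move=> h; apply/eqP; rewrite -leqn0 S_csets (leq_trans (csets_le _ _)) //.
by rewrite cardsT bin_small.
Qed.

Lemma coef_CS (G : sgraph) k : ((CS G)`_k)%R = S_ G k.
Proof.
rewrite /CS coef_sum.
under eq_bigr => i _ do rewrite coefZ coefXn.
have [->|k0] := posnP k.
  rewrite S_0 big_nat_cond big1 // => i /andP[/andP[i0 _] _].
  by rewrite ltn_eqF // GRing.mulr0.
have [hk|hk] := ltnP #|G| k.
  rewrite S_gt // big_nat_cond big1 // => i /andP[/andP[_ iG] _].
  by rewrite gtn_eqF ?GRing.mulr0 // (leq_trans _ hk).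
rewrite (bigD1_seq k) /= ?mem_index_iota ?k0 ?iota_uniq //.
rewrite eqxx GRing.mulr1 big1 ?GRing.addr0 // => i ik.
by rewrite eq_sym (negPf ik) GRing.mulr0.
Qed.

Lemma connected_set_star (G : sgraph) (A : {set G}) x : x \in A ->
  (forall y, y \in A -> y != x -> adj x y) -> connected_set A.
Proof.
move=> xA h; apply: connected_set_const => [|P hP]; first by apply/set0Pn; exists x.
have e y : y \in A -> P y = P x.
  by move=> yA; have [->//|yx] := eqVneq y x; apply/esym/hP => //; apply: h.
by move=> y z yA zA; rewrite !e.
Qed.

(** * Lower bounds for the coefficients of [CS (B n)] *)

Section LowerBn.
Variable n : nat.
Hypothesis n4 : 3 < n.
Let vc : B n := @Ordinal n 0 (ltn_trans (isT : 0 < 3) n4).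
Let va : B n := @Ordinal n 1 (ltn_trans (isT : 1 < 3) n4).
Let vb : B n := @Ordinal n 2 (ltn_trans (isT : 2 < 3) n4).
Let vw : B n := @Ordinal n 3 n4.

(** Every set containing the centre [vc] is connected, and the binomial counts all of them. *)
Lemma S_B_lower k : 'C(n.-1, k.+1) + #|csets ([set: B n] :\ vc) k.+2| <= S_ (B n) k.+2.
Proof.
rewrite S_csets (csets_split _ (in_setT vc)) addnC leq_add2l.
have := card_sets_at k.+1 (in_setT vc); rewrite cardsT card_ord => <-.
apply/subset_leq_card/subsetP => A.
rewrite inE in_csets_at => /and3P[-> -> cA]; rewrite cA andbT /=.
apply: (connected_set_star cA) => y yA yc.
by apply/orP; left; apply/orP; left.
Qed.

Lemma S_B_2 : n.+1 <= S_ (B n) 2.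
Proof.
apply: leq_trans (S_B_lower 0); rewrite bin1.
suff : 2 <= #|csets ([set: B n] :\ vc) 2| by move: n4; clear; lia.
apply: leq_trans (_ : #|[set [set va; vb]; [set va; vw]]| <= _).
  rewrite cards2; suff -> : [set va; vb] != [set va; vw] by [].
  by apply/eqP => /setP/(_ vb); rewrite !inE.
apply/subset_leq_card/subsetP => A hA; rewrite in_csets.
case/set2P: hA => ->; rewrite cards2; apply/and3P; split=> //;
  try (by apply/subsetP => x /set2P[]->; rewrite !inE);
  by apply: (connected_set_star (x := va)) => [|y /set2P[]-> //]; rewrite !inE eqxx.
Qed.

Lemma S_B_ge3 k : 'C(n.-1, k.+2) + (k == 0) <= S_ (B n) k.+3.
Proof.
apply: leq_trans (S_B_lower k.+1); rewrite leq_add2l; case: k => [|//].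
(* The extra triple is the path through [va], the one connected by edges off the centre. *)
apply/card_gt0P; exists (va |: [set vb; vw]); rewrite in_csets cardsU1 cards2 !inE.
apply/and3P; split=> //; first by apply/subsetP => x; rewrite !inE => /or3P[]/eqP->.
apply: (connected_set_star (x := va)) => [|y]; first by rewrite !inE eqxx.
by rewrite !inE => /or3P[]/eqP->.
Qed.

End LowerBn.

(** * Comparison of the coefficients *)

Theorem theorem4p5 (n : nat) (G : sgraph) (hn : 7 <= n) (horder : #|G| = n)
    (htype : type3 G) (hleaf : exists x : G, is_leaf x) :
  coef_le (CS G) (CS (B n)).
Proof.
have [/andP[conG /eqP eG] _] := htype.
have [H [H4 aH cH]] := theta_core htype.
(* All degrees inside [H] are at least 2, so the leaf rules out that [H] is everything. *)
have HT : H != setT.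
  case: hleaf => x /eqP dx; apply/eqP => HT.
  have := theta_dg_ge2 H4 cH (x := x); rewrite HT inE => /(_ isT).
  suff -> : dg [set: G] x = 1 by [].
  by rewrite -dx; apply: eq_card => y; rewrite !inE.
have aG : arcs [set: G] <= (#|G|.+1).*2.
  by have := arcs_edges G; rewrite eG; clear; lia.
have bG : csets_bound [set: G].
  by apply: (csets_bound_core (connected_setT conG) aG _ H4); rewrite ?horder.
have n4 : 3 < n by apply: leq_trans hn.
have le k : S_ G k <= S_ (B n) k.
  case: k => [|[|[|k]]]; first by rewrite S_0.
  - by rewrite !S_1 card_ord horder.
  - apply: leq_trans (S_2_edges G) _; rewrite eG horder addn1; exact: S_B_2.
  apply: leq_trans (S_B_ge3 n4 k); rewrite S_csets -horder -cardsT; exact: bG.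
split=> [|k]; last by rewrite !coef_CS.
(* The degrees compare because a coefficient vanishing for [B n] vanishes for [G]. *)
apply/leq_sizeP => j hj; apply/eqP; rewrite coef_CS -leqn0.
by apply: leq_trans (le j) _; rewrite -coef_CS nth_default.
Qed.
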